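(* Let $\Omega\subset\mathbb{R}^n$ be a bounded open set, $p>1$, and let $a=a(x,\mathrm z)$ satisfy $$a\in C(\bar\Omega\times\mathbb{R}^n;\mathbb{R}^n)\cap C^1(\bar\Omega\times(\mathbb{R}^n\setminus\{0\});\mathbb{R}^n),\qquad a(x,0)=0\ \text{ for }x\in\Omega,$$ $$\langle D_{\mathrm z}a(x,\mathrm z)\xi,\xi\rangle\ge(p-1)|\mathrm z|^{p-2}|\xi|^2,\qquad |D_{\mathrm z}a(x,\mathrm z)|\le C|\mathrm z|^{p-2}\qquad\text{for }(x,\mathrm z)\in\Omega\times(\mathbb{R}^n\setminus\{0\}),\ \xi\in\mathbb{R}^n,$$ for some constant $C>0$. Let $f\in C^1(\mathbb{R})$ satisfy $|f(t)|\le c|t|^{q-1}+d$, with $0<q\le p$ and $c,d\ge0$. Let $w$ be a bounded solution of $$-\operatorname{div}(a(x,\nabla w))=f(w)\ \text{in }\Omega,\qquad w=0\ \text{on }\partial\Omega .$$ Then, for $r>0$ and $\rho>1$, $$\|w\|_\infty\le\max\left\{C_1\|w\|_r^{\frac{rp}{n(p-q)+rp}},\ C_2\|w\|_r^{\frac{rp}{n(p-1)+rp}}\right\},$$ where $C_1=C_1(n,p,q,r,\rho,c)$ and $C_2=C_2(n,p,r,\rho,d)$ are positive constants depending only on the indicated quantities.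
   Context: Solutions are weak solutions in $W_0^{1,p}(\Omega)$. $\|w\|_r=\left(\int_\Omega|w|^r\,dx\right)^{1/r}$ for $r>0$. The number $\rho$ is an auxiliary parameter that may be fixed arbitrarily in $(1,\infty)$. *)

(* Defs.v *)
From HB Require Import structures.
From mathcomp Require Import all_boot all_order all_algebra.
From mathcomp Require Import all_classical all_reals all_analysis.

Set Implicit Arguments.
Unset Strict Implicit.
Unset Printing Implicit Defensive.
Import Order.TTheory GRing.Theory Num.Theory.
Import numFieldNormedType.Exports.

Local Open Scope classical_set_scope.
Local Open Scope ring_scope.

(* R^n is 'rV[R]_n.  Its library norm `|x| is the sup norm; it is used only
   through the topology, the Euclidean norm being [enorm] below. *)

(* The sigma-algebra on R^n generated by the coordinates, i.e. the n-fold
   product of the Borel sigma-algebra of R, which is the Borel one. *)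
Section measurable_rV.
Context {R : realType} (n : nat).

Definition coord_rV (i : 'I_n) (x : 'rV[R]_n) : measurableTypeR R := x ord0 i.

Let rV_set0 : g_sigma_preimage coord_rV set0.
Proof. exact: sigma_algebra0. Qed.

Let rV_setC A : g_sigma_preimage coord_rV A ->
  g_sigma_preimage coord_rV (~` A).
Proof. exact: sigma_algebraC. Qed.

Let rV_bigcup (F : (set 'rV[R]_n)^nat) :
  (forall i, g_sigma_preimage coord_rV (F i)) ->
  g_sigma_preimage coord_rV (\bigcup_i F i).
Proof. exact: sigma_algebra_bigcup. Qed.

HB.instance Definition _ := @isMeasurable.Build default_measure_display
  'rV[R]_n (g_sigma_preimage coord_rV) rV_set0 rV_setC rV_bigcup.

Lemma measurable_coord_rV (i : 'I_n) :
  measurable_fun [set: 'rV[R]_n] (coord_rV i).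
Proof.
move=> _ Y mY; rewrite setTI; apply: sub_sigma_algebra => /=.
rewrite -bigcup_seq/=; exists i => /=; first by rewrite mem_index_enum.
by exists Y => //; rewrite setTI.
Qed.

Lemma measurable_fun_rV d (T : measurableType d) (f : T -> 'rV[R]_n) :
  (forall i, measurable_fun [set: T] (coord_rV i \o f)) ->
  measurable_fun [set: T] f.
Proof.
move=> mf _ A; rewrite setTI.
move=> mA.
suff : image_set_system setT f measurable A by rewrite /image_set_system/= setTI.
move: A mA; apply: smallest_sub.
  exact/sigma_algebra_image/sigma_algebra_measurable.
move=> A /=; rewrite -bigcup_seq => -[i _ [B mB <-]].
by rewrite /image_set_system/= !setTI; have := mf i measurableT B mB; rewrite setTI.
Qed.

End measurable_rV.

Section lebesgue_measure_rV.
Context {R : realType}.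

Definition cons_rV n (p : measurableTypeR R * 'rV[R]_n) : 'rV[R]_n.+1 :=
  \row_i if unlift ord0 i is Some j then p.2 ord0 j else p.1.

Definition uncons_rV n (x : 'rV[R]_n.+1) : measurableTypeR R * 'rV[R]_n :=
  (x ord0 ord0, \row_j x ord0 (lift ord0 j)).

Lemma cons_rVK n : cancel (@cons_rV n) (@uncons_rV n).
Proof.
move=> [t x]; rewrite /uncons_rV /cons_rV mxE unlift_none; congr pair.
by apply/rowP => j; rewrite !mxE liftK.
Qed.

Lemma measurable_cons_rV n : measurable_fun setT (@cons_rV n).
Proof.
apply: measurable_fun_rV => i.
case: (unliftP ord0 i) => [j ->|->].
- rewrite (_ : _ \o _ = coord_rV j \o snd).
    exact: measurableT_comp (measurable_coord_rV j) measurable_snd.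
  by apply/funext => p; rewrite /coord_rV/= mxE liftK.
- rewrite (_ : _ \o _ = fst); first exact: measurable_fst.
  by apply/funext => p; rewrite /coord_rV/= mxE unlift_none.
Qed.

Lemma measurable_uncons_rV n : measurable_fun setT (@uncons_rV n).
Proof.
apply/measurable_fun_pairP; split.
  exact: (measurable_coord_rV (ord0 : 'I_n.+1)).
apply: measurable_fun_rV => i.
rewrite (_ : _ \o _ = coord_rV (lift ord0 i)); first exact: measurable_coord_rV.
by apply/funext => x; rewrite /coord_rV/= mxE.
Qed.

Section cons_measure.
Variables (n : nat) (m : {sigma_finite_measure set 'rV[R]_n -> \bar R}).

(* the product of lebesgue_measure and m, transported to 'rV_n.+1 *)
Definition cons_measure : set 'rV[R]_n.+1 -> \bar R :=
  pushforward (lebesgue_measure \x m)%E (@cons_rV n).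

Let measurable_preimage A : measurable A -> measurable (@cons_rV n @^-1` A).
Proof.
by move=> mA; rewrite -[X in measurable X]setTI; exact: measurable_cons_rV.
Qed.

Let cons_measure0 : cons_measure set0 = 0%E.
Proof. by rewrite /cons_measure /pushforward preimage_set0 measure0. Qed.

Let cons_measure_ge0 A : (0 <= cons_measure A)%E.
Proof. by rewrite /cons_measure /pushforward; apply: integral_ge0. Qed.

Let cons_measure_sigma_additive : semi_sigma_additive cons_measure.
Proof.
move=> F mF tF mUF; rewrite /cons_measure /pushforward preimage_bigcup.
apply: measure_semi_sigma_additive.
- by move=> i; exact: measurable_preimage.
- apply/trivIsetP => /= i j _ _ ij; rewrite -preimage_setI.
  by move/trivIsetP : tF => /(_ _ _ _ _ ij) ->//; rewrite preimage_set0.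
- by rewrite -preimage_bigcup; exact: measurable_preimage.
Qed.

HB.instance Definition _ := isMeasure.Build _ _ _ cons_measure
  cons_measure0 cons_measure_ge0 cons_measure_sigma_additive.

Let cons_measure_sigma_finite : sigma_finite setT cons_measure.
Proof.
have /sigma_finiteP[F [TF ndF Foo]] := sigma_finiteT (@lebesgue_measure R).
have /sigma_finiteP[G [TG ndG Goo]] := sigma_finiteT m.
exists (fun k => @uncons_rV n @^-1` (F k `*` G k)).
  apply/esym; rewrite -preimage_bigcup -subTset => x _ /=.
  have : setT (uncons_rV x).1 by [].
  have : setT (uncons_rV x).2 by [].
  rewrite {1}TG TF => -[k _ Gk] [l _ Fl]; exists (maxn k l) => //; split.
    by move: Fl; exact/subsetPset/ndF/leq_maxr.
  by move: Gk; exact/subsetPset/ndG/leq_maxl.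
move=> k; have [? ?] := Foo k; have [? ?] := Goo k; split.
  by rewrite -[X in measurable X]setTI; apply: measurable_uncons_rV => //;
    exact: measurableX.
rewrite /cons_measure /pushforward -comp_preimage (_ : _ \o _ = id).
  by rewrite preimage_id product_measure1E// lte_mul_pinfty// ge0_fin_numE.
by apply/funext => x; exact: cons_rVK.
Qed.

HB.instance Definition _ := Measure_isSigmaFinite.Build _ _ _ cons_measure
  cons_measure_sigma_finite.

End cons_measure.

Fixpoint lebesgue_rV n : {sigma_finite_measure set 'rV[R]_n -> \bar R} :=
  if n is n'.+1 then cons_measure (lebesgue_rV n') else \d_(0 : 'rV[R]_0).

Lemma measurable_box n (A : 'I_n -> set (measurableTypeR R)) :
  (forall i, measurable (A i)) ->
  measurable [set x : 'rV[R]_n | forall i, A i (x ord0 i)].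
Proof.
move=> mA; rewrite (_ : [set x | _] =
    \bigcap_(i in [set: 'I_n]) (coord_rV i @^-1` A i)); last first.
  by apply/seteqP; split => x /= Ax i => [_|]; exact: Ax.
apply: fin_bigcap_measurable => // i _.
by have := @measurable_coord_rV R n i measurableT _ (mA i); rewrite setTI.
Qed.

Lemma lebesgue_rV_box n (A : 'I_n -> set (measurableTypeR R)) :
  (forall i, measurable (A i)) ->
  lebesgue_rV n [set x | forall i, A i (x ord0 i)] =
    (\prod_(i < n) lebesgue_measure (A i))%E.
Proof.
elim: n A => [|n IH] A mA.
  by rewrite big_ord0 /= diracE mem_set//= => -[].
rewrite big_ord_recl -IH//= -product_measure1E//; last first.
  by apply: (@measurable_box n (fun i => A (lift ord0 i))) => i; exact: mA.
rewrite /cons_measure /pushforward; congr (product_measure1 _ _ _).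
apply/seteqP; split => -[t x] /=.
  move=> Ax; split; first by have := Ax ord0; rewrite mxE unlift_none.
  by move=> i; have := Ax (lift ord0 i); rewrite mxE liftK.
move=> [At Ax] i; rewrite mxE.
by case: (unliftP ord0 i) => [j ->|->].
Qed.

End lebesgue_measure_rV.

Section sobolev.
Context {R : realType} {n : nat}.
Implicit Types (Omega : set 'rV[R]_n) (u w phi : 'rV[R]_n -> R)
  (g : 'rV[R]_n -> 'rV[R]_n) (i : 'I_n).

Definition dot (x y : 'rV[R]_n) : R := \sum_i x ord0 i * y ord0 i.

Definition enorm (x : 'rV[R]_n) : R := Num.sqrt (dot x x).

Definition partial i phi : 'rV[R]_n -> R := 'D_(delta_mx ord0 i) phi.

Definition gradient phi (x : 'rV[R]_n) : 'rV[R]_n := \row_i partial i phi x.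

(* ||u||_s over Omega, for 0 < s <= +oo *)
Definition LnormOn Omega (s : \bar R) u : \bar R :=
  'N[lebesgue_rV n]_s[EFin \o (u \_ Omega)]%E.

Definition in_Lp Omega (p : R) u : Prop :=
  measurable_fun Omega u /\ (LnormOn Omega p%:E u < +oo)%E.

Fixpoint Ck (k : nat) phi : Prop :=
  if k is k'.+1 then
    (forall x, differentiable phi x) /\ (forall i, Ck k' (partial i phi))
  else continuous phi.

Definition support phi : set 'rV[R]_n := closure [set x | phi x != 0].

(* C_c^oo(Omega), its elements being extended by 0 outside Omega *)
Definition test_function Omega phi : Prop :=
  [/\ (forall k, Ck k phi), compact (support phi) & support phi `<=` Omega].

Definition weak_gradient Omega u g : Prop :=
  forall phi, test_function Omega phi -> forall i,
    (\int[lebesgue_rV n]_(x in Omega) (u x * partial i phi x)%:E =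
     - \int[lebesgue_rV n]_(x in Omega) (g x ord0 i * phi x)%:E)%E.

(* u belongs to W^{1,p}(Omega), with weak gradient g *)
Definition W1p Omega (p : R) u g : Prop :=
  [/\ in_Lp Omega p u, forall i, in_Lp Omega p (fun x => g x ord0 i)
    & weak_gradient Omega u g].

(* u belongs to the closure W_0^{1,p}(Omega) of C_c^oo(Omega) in
   W^{1,p}(Omega), with weak gradient g *)
Definition W1p0 Omega (p : R) u g : Prop :=
  W1p Omega p u g /\
  exists phi : nat -> 'rV[R]_n -> R,
    [/\ forall k, test_function Omega (phi k),
        (fun k => LnormOn Omega p%:E (fun x => phi k x - u x)) @ \oo --> 0%E
      & forall i, (fun k => LnormOn Omega p%:E
          (fun x => partial i (phi k) x - g x ord0 i)) @ \oo --> 0%E].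

(* -div (a(x, grad w)) = f(w) in Omega, w = 0 on the boundary *)
Definition weak_solution Omega (p : R) (a : 'rV[R]_n -> 'rV[R]_n -> 'rV[R]_n)
    (f : R -> R) w : Prop :=
  exists2 g, W1p0 Omega p w g &
    forall phi, test_function Omega phi ->
      (\int[lebesgue_rV n]_(x in Omega) (dot (a x (g x)) (gradient phi x))%:E =
       \int[lebesgue_rV n]_(x in Omega) (f (w x) * phi x)%:E)%E.

(* a is C^1 on closure Omega x (R^n \ {0}), in the usual sense for a set that
   need not be open: C^1 on Omega x (R^n \ {0}), with first derivatives that
   extend continuously to closure Omega x (R^n \ {0}). *)
Definition C1_closure Omega (a : 'rV[R]_n -> 'rV[R]_n -> 'rV[R]_n) : Prop :=
  let A (y : 'rV[R]_n * 'rV[R]_n) := a y.1 y.2 in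
  (forall x z, Omega x -> z != 0 -> differentiable A (x, z)) /\
  forall v, exists2 h : 'rV[R]_n * 'rV[R]_n -> 'rV[R]_n,
    {within closure Omega `*` ~` [set 0], continuous h} &
    forall x z, Omega x -> z != 0 -> h (x, z) = 'D_v A (x, z).

Definition structure_conditions Omega (p : R)
    (a : 'rV[R]_n -> 'rV[R]_n -> 'rV[R]_n) : Prop :=
  [/\ {within closure Omega `*` [set: 'rV[R]_n],
         continuous (fun y : 'rV[R]_n * 'rV[R]_n => a y.1 y.2)},
      C1_closure Omega a,
      forall x, Omega x -> a x 0 = 0,
      forall x z xi, Omega x -> z != 0 ->
        (p - 1) * enorm z `^ (p - 2) * enorm xi ^+ 2
          <= dot ('d (a x) z xi) xi
    & exists2 C : R, 0 < C &
        (* |D_z a(x, z)| is the operator norm *)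
        forall x z xi, Omega x -> z != 0 ->
          enorm ('d (a x) z xi) <= C * enorm z `^ (p - 2) * enorm xi].

End sobolev.

(* |f(t)| <= c |t|^(q-1) + d.  For q < 1 and t = 0 the right-hand side is
   +oo, so nothing is required, whereas powR gives 0 `^ (q - 1) = 0. *)
Definition growth_condition {R : realType} (q c d : R) (f : R -> R) : Prop :=
  forall t, t != 0 \/ 1 <= q -> `|f t| <= c * `|t| `^ (q - 1) + d.

(* Main.v *)
Require Import Defs.
From mathcomp Require Import all_boot all_order all_algebra.
From mathcomp Require Import all_classical all_reals all_analysis.
From mathcomp Require Import measurable_realfun ess_sup_inf.
From mathcomp Require Import ring lra.
Import Order.TTheory GRing.Theory Num.Theory.
Import numFieldNormedType.Exports.
Local Open Scope classical_set_scope.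
Local Open Scope ring_scope.

(** Integrating [D_z a] along the ray [t z] turns the structure conditions into
    [<a(x,z),z> >= |z|^p] and [|a(x,z)| <= C |z|^(p-1)].  With [M = ||w||_oo]
    and [M/2 <= k < h], test the equation with a smooth truncation [v] of [w]
    at levels between [k] and [h]: on the support of [v] one has
    [|f(w)| <= Lambda := 2 (c+1) M^(q-1) + d + 1], so the energy
    [\int |grad v|^p] is bounded by [Lambda \int |v|].  The Sobolev inequality
    is replaced by [\int |v| <= 2 L \sum_i \int |d_i v|] for functions whose
    support has measure [L^n / 2], which only uses translation invariance.
    Together they give De Giorgi's decay
    [A(h) <= K Lambda^(1/(p-1)) A(k)^(1+theta) / (h-k)], with
    [theta = p/(n(p-1))], for the measure [A(k)] of [{|w| > k}].  Hence
    [M <= C Lambda^(1/(p-1)) A(M/2)^theta]; Chebyshev's inequality for [A(M/2)]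
    and a comparison of the two terms of [Lambda] give the two alternatives.

    In the energy estimate [w] is replaced by one approximating test function,
    up to errors that are made small at the end, so that the truncation need
    not be shown to act on [W_0^(1,p)]. *)

Set Implicit Arguments.
Unset Strict Implicit.
Unset Printing Implicit Defensive.

(** * Borel sets and translations in R^n *)

(** Starting at the level M/2 is what makes the growth of [f] usable for q < 1, where |t|^(q-1)
    blows up at 0: for M/2 < |t| <= M it is at most 2 M^(q-1). The summands +1 keep [Lambda] and the
    final constants positive even when c = d = 0. The energy bound has \int |v| on its right-hand
    side. Young's inequality |g| <= delta + delta^(1-p) |g|^p links it to the L^1 Poincare
    inequality, and delta is chosen so that exactly half of \int |v| is absorbed. This makes delta a
    multiple of (L Lambda)^(1/(p-1)); as L^n is proportional to A(k), the product L delta produces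
    the power theta. A test function phi is close to w only in integral norms, so its superlevel set
    at k is compared with that of w at a slightly lower level, the exceptional set being small by
    Chebyshev. Where |w| <= k the bound [Lambda] on f(w) may fail, but there the truncated phi is at
    most |phi - w|, so a crude bound on f(w) times a small error suffices. *)

Lemma bigcup_measurable_count d (T : measurableType d) (I : countType)
    (P : set I) (F : I -> set T) :
  (forall i, P i -> measurable (F i)) -> measurable (\bigcup_(i in P) F i).
Proof.
move=> mF.
rewrite (_ : \bigcup_(i in P) F i = \bigcup_k
    (if unpickle k is Some i then (if pselect (P i) then F i else set0)
     else set0)).
  apply: bigcupT_measurable => k; case: unpickle => [i|]; last exact: measurable0.
  by case: pselect => Pi; [exact: mF|exact: measurable0].
apply/seteqP; split=> x.
  move=> [i Pi Fix]; exists (pickle i) => //; rewrite pickleK.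
  by case: pselect.
move=> [k _]; case: unpickle => [i|//].
by case: pselect => // Pi Fix; exists i.
Qed.

Section rV_borel.
Context {R : realType}.

(** A countable base of the topology. The sigma-algebra is generated by the coordinates, so open
    sets reach it only as countable unions of such boxes. *)
Definition rbox {n} (q : 'rV[rat]_n * nat) : set 'rV[R]_n :=
  [set y | forall i, ball (ratr (q.1 ord0 i) : R) q.2.+1%:R^-1 (y ord0 i)].

Lemma measurable_rbox n (q : 'rV[rat]_n * nat) : measurable (rbox q).
Proof.
apply: (@measurable_box R n (fun i => ball (ratr (q.1 ord0 i) : R) q.2.+1%:R^-1)).
move=> i; by apply: open_measurable; apply: ball_open.
Qed.

Lemma nbhs_rbox n (x : 'rV[R]_n) (U : set 'rV[R]_n) : nbhs x U ->
  exists q, rbox q x /\ rbox q `<=` U.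
Proof.
move=> /nbhs_ballP [e /= e0 eU].
(* [x] and any other point of the box lie within [1/(k+1)] of the rational centre in each
   coordinate, hence within [e] of each other. *)
have [k ke] : exists k : nat, k.+1%:R^-1 < e / 2.
  have e2 : 0 < e / 2 by rewrite divr_gt0.
  by have [k] := ltr_add_invr (y:=0) (x:=e/2) e2; rewrite add0r; exists k.
have ki : 0 < k.+1%:R^-1 :> R by rewrite invr_gt0.
set d := k.+1%:R^-1 in ke ki.
have /choice [q qP] : forall i, exists q : rat, ball (ratr q : R) d (x ord0 i).
  move=> i.
  have [|q] := @rat_in_itvoo R (x ord0 i - d) (x ord0 i + d).
    by lra.
  rewrite in_itv/= => /andP[h1 h2]; exists q.
  by rewrite /ball/= ltr_norml; apply/andP; split; lra.
exists (\row_i q i, k); split=> [i|y yq]; first by rewrite /= mxE; exact: qP.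
apply: eU; split => // i j; rewrite ord1.
have := yq j; have := qP j; rewrite /= mxE -/d /ball/=.
rewrite (ltr_distlC (ratr (q j))) => /andP[h1 h2].
rewrite (ltr_distlC (ratr (q j))) => /andP[h3 h4].
by rewrite /ball/= ltr_norml; apply/andP; split; lra.
Qed.

Lemma open_measurable_rV n (U : set 'rV[R]_n) : open U -> measurable U.
Proof.
move=> oU; rewrite (_ : U = \bigcup_(q in [set q | rbox q `<=` U]) rbox q).
  by apply: bigcup_measurable_count => q _; exact: measurable_rbox.
apply/seteqP; split=> [x Ux|x [q qU]]; last exact: qU.
have [q [qx qU]] := nbhs_rbox (oU x Ux).
by exists q.
Qed.

Lemma open_measurable_rVX n m (U : set ('rV[R]_n * 'rV[R]_m)) :
  open U -> measurable U.
Proof.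
move=> oU; rewrite (_ : U = \bigcup_(q in [set q | rbox q.1 `*` rbox q.2 `<=` U])
    (rbox q.1 `*` rbox q.2)).
  apply: bigcup_measurable_count => q _.
  by apply: measurableX; exact: measurable_rbox.
apply/seteqP; split=> [x Ux|x [q qU]]; last exact: qU.
have [[A B] /= [Ax Bx] AB] := oU x Ux.
have [q [qx qU]] := nbhs_rbox Ax.
have [q' [qx' qU']] := nbhs_rbox Bx.
exists (q, q') => //= -[y z] [/= yq zq]; apply: AB; split => /=.
  exact: qU.
exact: qU'.
Qed.

Lemma continuous_measurable_rV n (f : 'rV[R]_n -> R) :
  continuous f -> measurable_fun setT f.
Proof.
move=> cf; apply: (measurability _ (RGenOpens.measurableE R)).
move=> _ [_ [a [b ->] <-]]; rewrite setTI.
apply: open_measurable_rV.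
by apply: open_comp => // x _; exact: cf.
Qed.

Lemma measurable_shift n (h : 'rV[R]_n) :
  measurable_fun setT (fun x : 'rV[R]_n => x + h).
Proof.
apply: measurable_fun_rV => i.
rewrite (_ : _ \o _ = (fun x => coord_rV i x + h ord0 i)).
  by apply: measurable_funD => //; exact: measurable_coord_rV.
by apply/funext => x; rewrite /coord_rV/= mxE.
Qed.

End rV_borel.

Section translation.
Context {R : realType}.

Lemma measurable_shift1 (h : R) :
  measurable_fun setT (fun t : measurableTypeR R => (t + h : measurableTypeR R)).
Proof. exact: measurable_funD. Qed.

Lemma lebesgue_measure_shift (h : R) (A : set (measurableTypeR R)) :
  measurable A ->
  lebesgue_measure ((fun t : R => t + h) @^-1` A) = lebesgue_measure A.
Proof.
move=> mA.
pose nu := measure_function_pushforward__canonical__measure_function_Measure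
  (@lebesgue_measure R) (measurable_shift1 h).
rewrite (_ : lebesgue_measure (_ @^-1` _) = nu A)//.
apply/esym; apply: lebesgue_measure_unique => // _ [[a b] _ <-] /=.
rewrite /pushforward (_ : _ @^-1` _ = `]a - h, b - h]%classic); last first.
  by apply/seteqP; split=> x /=; rewrite !in_itv/= ltrBlDr lerBrDr.
rewrite !lebesgue_measure_itv/= !lte_fin ltrD2r.
by case: ifP => // _; rewrite -!EFinB; congr EFin; ring.
Qed.

Lemma integral_shift1 (h : R) (f : measurableTypeR R -> \bar R) :
  measurable_fun setT f -> (forall t, 0 <= f t)%E ->
  (\int[lebesgue_measure]_t f (t + h)%R = \int[lebesgue_measure]_t f t)%E.
Proof.
move=> mf f0.
pose nu := measure_function_pushforward__canonical__measure_function_Measure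
  (@lebesgue_measure R) (measurable_shift1 h).
transitivity (\int[nu]_t f t)%E; last first.
  by apply: eq_measure_integral => A mA _; exact: lebesgue_measure_shift.
have := ge0_integral_pushforward (measurable_shift1 h) (@lebesgue_measure R)
  measurableT mf.
by rewrite preimage_setT => ->.
Qed.

(** Induction on the dimension: the measure of [A] integrates the measures of its slices. The outer
    variable absorbs the first coordinate of [h], the induction hypothesis absorbs the others in
    each slice. *)
Lemma lebesgue_rV_shift n (h : 'rV[R]_n) (A : set 'rV[R]_n) :
  measurable A ->
  lebesgue_rV n ((fun x => x + h) @^-1` A) = lebesgue_rV n A.
Proof.
elim: n h A => [|n IH] h A mA.
  rewrite (_ : _ @^-1` A = A)//; apply/funext => x /=.
  by congr A; apply/rowP => -[].
rewrite /= /cons_measure /pushforward /product_measure1.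
pose S := @cons_rV R n @^-1` A.
have mS : measurable S.
  by rewrite -[X in measurable X]setTI; exact: measurable_cons_rV.
rewrite -(integral_shift1 (h ord0 ord0) (f := lebesgue_rV n \o xsection S)); last 2 first.
  exact: measurable_fun_xsection.
  by move=> t; exact: measure_ge0.
apply: eq_integral => t _ /=.
rewrite -(IH (\row_j h ord0 (lift ord0 j)) (xsection S _)); last exact: measurable_xsection.
congr (lebesgue_rV n _); apply/seteqP; split=> x.
all: rewrite /= /xsection/= !inE /S/=.
all: rewrite (_ : cons_rV (t, x) + h = cons_rV
  (t + h ord0 ord0, x + \row_j h ord0 (lift ord0 j)))//.
all: apply/rowP => i; rewrite !mxE /=.
all: by case: (unliftP ord0 i) => [j ->|->]; rewrite /= ?mxE.
Qed.

Lemma integral_shift n (h : 'rV[R]_n) (f : 'rV[R]_n -> \bar R) :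
  measurable_fun setT f -> (forall t, 0 <= f t)%E ->
  (\int[lebesgue_rV n]_x f (x + h)%R = \int[lebesgue_rV n]_x f x)%E.
Proof.
move=> mf f0.
pose nu := measure_function_pushforward__canonical__measure_function_Measure
  (lebesgue_rV n) (measurable_shift h).
transitivity (\int[nu]_t f t)%E; last first.
  by apply: eq_measure_integral => A mA _; exact: lebesgue_rV_shift.
have := ge0_integral_pushforward (measurable_shift h) (lebesgue_rV n)
  measurableT mf.
by rewrite preimage_setT => ->.
Qed.

End translation.

(** * A Poincare inequality in terms of the measure of the support *)

Section line.
Context {R : realType} {V W : normedModType R}.

(** The two difference quotients are the same function, so derivability and derivatives along a line
    transfer with no chain rule and no differentiability of [f]. *)
Lemma line_quotient (f : V -> W) (x h : V) (t : R) :
  (fun s : R => s^-1 *: (((fun t : R => f (x + t *: h)) \o shift t) (s *: (1 : R)) - f (x + t *: h)))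
  = (fun s => s^-1 *: ((f \o shift (x + t *: h)) (s *: h) - f (x + t *: h))).
Proof.
apply/funext => s /=; congr (_ *: (f _ - _)).
by rewrite /GRing.scale/= mulr1 [RHS]addrC -addrA -scalerDl [t + s]addrC.
Qed.

Lemma derive_line (f : V -> W) (x h : V) (t : R) :
  'D_1 (fun t : R => f (x + t *: h)) t = 'D_h f (x + t *: h).
Proof. by rewrite /derive -line_quotient. Qed.

Lemma derivable_line (f : V -> W) (x h : V) (t : R) :
  derivable f (x + t *: h) h -> derivable (fun t : R => f (x + t *: h)) t 1.
Proof. by rewrite /derivable line_quotient. Qed.

End line.

Section partials.
Context {R : realType} {n : nat}.
Implicit Types v : 'rV[R]_n -> R.

Lemma derive_partial v x h : differentiable v x ->
  'D_h v x = \sum_i h ord0 i * partial i v x.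
Proof.
move=> dv; rewrite deriveE// {1}(row_sum_delta h) raddf_sum/=.
apply: eq_bigr => i _; rewrite linearZ/= /partial deriveE//.
Qed.

Lemma continuous_line (x h : 'rV[R]_n) : continuous (fun t : R => x + t *: h).
Proof.
move=> t; apply: cvgD; first exact: cvg_cst.
by apply: cvgZr_tmp; exact: cvg_id.
Qed.

(** The fundamental theorem of calculus along the segment from [x] to [x + h]. *)
Lemma increment_le v (x h : 'rV[R]_n) :
  (forall x, differentiable v x) -> (forall i, continuous (partial i v)) ->
  (`|v (x + h)%R - v x|%:E <= \int[lebesgue_measure]_(t in `[0%R, 1%R])
     (\sum_i `|h ord0 i| * `|partial i v (x + t *: h)|)%:E)%E.
Proof.
move=> dv cv.
pose F (t : R) := v (x + t *: h).
pose f (t : R) := \sum_i h ord0 i * partial i v (x + t *: h).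
have dF t : derivable F t 1.
  by apply: derivable_line; apply: diff_derivable.
have F'f t : F^`()%classic t = f t.
  by rewrite derive1E derive_line derive_partial.
have cf : continuous f.
  apply: (continuous_big (op := +%R)); first exact: add_continuous.
  move=> i _ t; apply: cvgMl_tmp.
  apply: (@continuous_comp _ _ _ (fun t : R => x + t *: h) (partial i v)).
    exact: continuous_line.
  exact: cv.
have cF : continuous F.
  by move=> t; apply/differentiable_continuous/derivable1_diffP.
have := @continuous_FTC2 R f F 0 1 ltr01 (continuous_subspaceT cf).
have -> : v x = F 0 by rewrite /F scale0r addr0.
have -> : v (x + h) = F 1 by rewrite /F scale1r.
move=> FTC.
rewrite -abse_EFin EFinB -FTC; last 2 first.
  split => //.
  - by apply: cvg_at_right_filter; exact: cF.
  - by apply: cvg_at_left_filter; exact: cF.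
  by move=> t _; exact: F'f.
have mf : measurable_fun (`[0, 1]%classic : set (measurableTypeR R)) (EFin \o f).
  by apply/measurable_EFinP; apply: measurable_funTS; exact: continuous_measurable_fun.
apply: (le_trans (le_abse_integral lebesgue_measure _ mf)) => //.
have mp i : measurable_fun setT (fun t : measurableTypeR R => partial i v (x + t *: h)).
  apply: continuous_measurable_fun => t.
  apply: (@continuous_comp _ _ _ (fun t : R => x + t *: h) (partial i v)).
    exact: continuous_line.
  exact: cv.
apply: ge0_le_integral => //=.
- apply/measurable_EFinP; apply: measurableT_comp => //; exact/measurable_EFinP.
- apply/measurable_EFinP; apply: measurable_funTS.
  apply: measurable_sum => i; apply: measurable_funM => //.
  exact: (measurableT_comp (@normr_measurable R setT) (mp i)).
- move=> t _; rewrite lee_fin; apply: (le_trans (ler_norm_sum _ _ _)).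
  by apply: ler_sum => i _; rewrite normrM.
Qed.

(** After integrating the segment bound over [x] and exchanging the integrals, translation
    invariance removes the shift by [t *: h] for each fixed [t]. *)
Lemma translation_le v (h : 'rV[R]_n) :
  (forall x, differentiable v x) -> (forall i, continuous (partial i v)) ->
  (\int[lebesgue_rV n]_x `|v (x + h)%R - v x|%:E <=
   \sum_i `|h ord0 i|%:E * \int[lebesgue_rV n]_x `|partial i v x|%:E)%E.
Proof.
move=> dv cv.
have cvv : continuous v by move=> x; apply: differentiable_continuous.
have mv : measurable_fun setT v := continuous_measurable_rV cvv.
pose P (y : 'rV[R]_n) := \sum_i `|h ord0 i| * `|partial i v y|.
have mP : measurable_fun setT P.
  apply: measurable_sum => i; apply: measurable_funM => //.
  apply: measurableT_comp => //; exact: continuous_measurable_rV.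
have P0 y : 0 <= P y by apply: sumr_ge0 => i _; rewrite mulr_ge0.
(* The interval enters through an indicator so that [f] is defined on the full product, where
   Tonelli applies. *)
pose f (z : 'rV[R]_n * measurableTypeR R) : \bar R :=
  (\1_(`[0, 1]%classic : set (measurableTypeR R)) z.2 * P (z.1 + z.2 *: h))%:E.
have mf : measurable_fun setT f.
  apply/measurable_EFinP; apply: measurable_funM.
    have mI : measurable_fun setT
        (\1_(`[0, 1]%classic : set (measurableTypeR R)) : _ -> R).
      exact: measurable_indic.
    exact: (measurableT_comp mI measurable_snd).
  apply: (measurableT_comp mP); apply: measurable_fun_rV => i.
  rewrite (_ : _ \o _ = fun z => coord_rV i z.1 + z.2 * h ord0 i).
    apply: measurable_funD.
      apply: (measurableT_comp (measurable_coord_rV i)) => //.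
    by apply: measurable_funM => //.
  by apply/funext => z; rewrite /coord_rV/= !mxE.
have f0 z : (0 <= f z)%E by rewrite lee_fin mulr_ge0.
apply: (@le_trans _ _ (\int[lebesgue_rV n]_x \int[lebesgue_measure]_t f (x, t))%E).
  apply: ge0_le_integral => //.
  - apply/measurable_EFinP; apply: measurableT_comp => //.
    by apply: measurable_funB => //; apply: measurableT_comp => //; exact: measurable_shift.
  - exact: (measurable_fun_fubini_tonelli_F f).
  - move=> x _; apply: (le_trans (increment_le x h dv cv)).
    rewrite integral_mkcond le_eqVlt; apply/orP; left; apply/eqP.
    apply: eq_integral => t _; rewrite patchE /f/= indicE.
    by case: ifPn => _; rewrite ?mul1r ?mul0r.
rewrite fubini_tonelli//.
have E t : (\int[lebesgue_rV n]_x f (x, t))%E =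
    ((\1_(`[0%R, 1%R]%classic : set (measurableTypeR R)) t)%:E * \int[lebesgue_rV n]_x (P x)%:E)%E.
  rewrite /f/=; under eq_integral do rewrite EFinM.
  rewrite (@ge0_integralZl _ _ _ (lebesgue_rV n) setT measurableT
    (fun x => (P (x + t *: h))%:E)); last 3 first.
  - by apply/measurable_EFinP; apply: (measurableT_comp mP); exact: measurable_shift.
  - by move=> x _; rewrite lee_fin.
  - by rewrite lee_fin.
  have mEP : measurable_fun setT (EFin \o P) by exact/measurable_EFinP.
  have I : (\int[lebesgue_rV n]_x (P (x + t *: h))%:E =
    \int[lebesgue_rV n]_x (P x)%:E)%E.
    by apply: (integral_shift (t *: h) mEP) => x /=; rewrite lee_fin.
  by rewrite I.
rewrite (eq_integral _ _ (fun t _ => E t)) ge0_integralZr//; last 2 first.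
- by apply/measurable_EFinP.
- by apply: integral_ge0 => x _; rewrite lee_fin.
rewrite integral_indic// setIT.
have I01 : lebesgue_measure (`[0, 1]%classic : set (measurableTypeR R)) = 1%E.
  by rewrite lebesgue_measure_itv/= lte_fin ltr01 oppr0 adde0.
rewrite [X in (X * _)%E](_ : _ = 1%E); last exact: I01.
rewrite mul1e.
rewrite /P; under eq_integral do rewrite -sumEFin.
rewrite ge0_integral_sum//; last first.
- move=> i; apply/measurable_EFinP; apply: measurable_funM => //.
  by apply: measurableT_comp => //; exact: continuous_measurable_rV.
apply: lee_sum => i _; under eq_integral do rewrite EFinM.
rewrite ge0_integralZl ?lee_fin//.
by apply/measurable_EFinP; apply: measurableT_comp => //; exact: continuous_measurable_rV.
Qed.

End partials.

Section poincare.
Context {R : realType} {n : nat}.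
Implicit Types v : 'rV[R]_n -> R.

Lemma lebesgue_rV_cube (L : R) : 0 <= L ->
  lebesgue_rV n [set h : 'rV[R]_n | forall i, `[0, L]%classic (h ord0 i)] =
  (L ^+ n)%:E.
Proof.
move=> L0.
have E := @lebesgue_rV_box R n (fun=> `[0, L]%classic) (fun=> measurable_itv `[0, L]).
rewrite [LHS]E.
have I : lebesgue_measure (`[0, L]%classic : set (measurableTypeR R)) = L%:E.
  rewrite lebesgue_measure_itv/= lte_fin oppr0 adde0.
  by move: L0; rewrite le_eqVlt => /predU1P[<-|->]//; rewrite ltxx.
under eq_bigr do rewrite I.
by rewrite prodEFin prodr_const card_ord.
Qed.

(* Averaging [v (x + h)] over a cube of volume twice the measure of the
   support of [v] recovers at most half of [v], so the increments control
   the other half. *)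
Lemma poincare_support v (B L : R) :
  (forall x, differentiable v x) -> (forall i, continuous (partial i v)) ->
  0 < B -> 0 <= L -> L ^+ n = 2 * B ->
  (lebesgue_rV n [set x | v x != 0%R] <= B%:E)%E ->
  (\int[lebesgue_rV n]_x `|v x|%:E < +oo)%E ->
  (\int[lebesgue_rV n]_x `|v x|%:E <=
   (2 * L)%:E * \sum_i \int[lebesgue_rV n]_x `|partial i v x|%:E)%E.
Proof.
move=> dv cv B0 L0 LB SB Ioo.
have cvv : continuous v by move=> x; apply: differentiable_continuous.
have mv : measurable_fun setT v := continuous_measurable_rV cvv.
have mnv : measurable_fun setT (fun x => `|v x|%:E).
  by apply/measurable_EFinP; apply: measurableT_comp.
pose S := [set x | v x != 0].
have mS : measurable S.
  apply: open_measurable_rV; rewrite (_ : S = v @^-1` [set y | y != 0])//.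
  by apply: open_comp => [x _|]; [exact: cvv|exact: open_neq].
pose Q := [set h : 'rV[R]_n | forall i, `[0, L]%classic (h ord0 i)].
have mQ : measurable Q := @measurable_box R n (fun=> `[0, L]%classic)
  (fun=> measurable_itv `[0, L]).
set I := (\int[_]_x `|v x|%:E)%E in Ioo *.
set D := (\sum_i _)%E.
have D0 : (0 <= D)%E.
  by apply: sume_ge0 => i _; apply: integral_ge0 => x _; rewrite lee_fin.
have I0 : (0 <= I)%E by apply: integral_ge0 => x _; rewrite lee_fin.
pose f (z : 'rV[R]_n * 'rV[R]_n) : \bar R := (\1_S z.2 * `|v (z.2 + z.1)|)%:E.
have madd : measurable_fun setT (fun z : 'rV[R]_n * 'rV[R]_n => z.2 + z.1).
  apply: measurable_fun_rV => i.
  rewrite (_ : _ \o _ = fun z => coord_rV i z.2 + coord_rV i z.1).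
    by apply: measurable_funD;
      apply: (measurableT_comp (measurable_coord_rV i)).
  by apply/funext => z; rewrite /coord_rV/= !mxE.
have mI : measurable_fun setT (\1_S : _ -> R) by exact: measurable_indic.
have mf : measurable_fun setT f.
  apply/measurable_EFinP; apply: measurable_funM.
    exact: (measurableT_comp mI measurable_snd).
  by apply: measurableT_comp => //; exact: measurableT_comp.
have f0 z : (0 <= f z)%E by rewrite lee_fin mulr_ge0.
pose F h := (\int[lebesgue_rV n]_x f (h, x))%E.
have mF : measurable_fun setT F := measurable_fun_fubini_tonelli_F f mf f0.
have F0 h : (0 <= F h)%E by exact: integral_ge0.
have IF h : Q h -> (I <= F h + L%:E * D)%E.
  move=> Qh.
  have sh := translation_le h dv cv.
  have mvh : measurable_fun setT (fun x : 'rV[R]_n => `|v (x + h)%R - v x|%:E).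
    apply/measurable_EFinP; apply: measurableT_comp => //.
    by apply: measurable_funB => //; apply: measurableT_comp => //; exact: measurable_shift.
  have mfh : measurable_fun setT (fun x => f (h, x)).
    exact: (measurableT_comp mf (measurable_pair1 h)).
  apply: (@le_trans _ _ (F h + \int[lebesgue_rV n]_x `|v (x + h)%R - v x|%:E)%E).
    rewrite /F -ge0_integralD//.
    apply: ge0_le_integral => //; first exact: emeasurable_funD.
    (* On the support this is the triangle inequality through [v (x + h)]; off it the left-hand side
       is 0. *)
    move=> x _; rewrite /f/= -EFinD lee_fin indicE.
    have [Sx|] := boolP (x \in S).
      rewrite mul1r -{1}[v x](subKr (v (x + h))).
      by rewrite (le_trans (ler_normB _ _))// lexx.
    rewrite notin_setE/= => /negP; rewrite negbK => /eqP ->.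
    by rewrite normr0 mul0r add0r.
  apply: leeD2l; apply: (le_trans sh).
  rewrite ge0_sume_distrr; last first.
    by move=> i _; apply: integral_ge0 => x _; rewrite lee_fin.
  apply: lee_sum => i _; apply: lee_wpmul2r.
    by apply: integral_ge0 => x _; rewrite lee_fin.
  by rewrite lee_fin; have := Qh i; rewrite /= in_itv/= => /andP[h0 hL]; rewrite ger0_norm.
(* [IF] is integrated over the cube [Q] of volume [2 * B]. Enlarging the domain of [h] to the whole
   space and exchanging the integrals turns the integral of [F] into the measure of [S] times
   [I]. *)
have step1 : (I * (2 * B)%:E <= B%:E * I + L%:E * D * (2 * B)%:E)%E.
  have muQ : lebesgue_rV n Q = (2 * B)%:E by rewrite -LB; exact: lebesgue_rV_cube.
  rewrite -muQ -!integral_cst//.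
  apply: (@le_trans _ _ (\int[lebesgue_rV n]_(h in Q) (F h + L%:E * D))%E).
    apply: ge0_le_integral => //.
    apply: emeasurable_funD => //; exact: measurable_funTS.
  rewrite ge0_integralD//; last 2 first.
    exact: measurable_funTS.
    by move=> h _; rewrite mule_ge0.
  rewrite integral_cst//; apply: leeD2r.
  apply: (@le_trans _ _ (\int[lebesgue_rV n]_h F h)%E).
    exact: ge0_subset_integral.
  rewrite /F (fubini_tonelli f)//.
  have E x : (\int[lebesgue_rV n]_h f (h, x))%E = ((\1_S x)%:E * I)%E.
    rewrite /f/=; under eq_integral do rewrite EFinM.
    rewrite (@ge0_integralZl _ _ _ (lebesgue_rV n) setT measurableT
      (fun h : 'rV[R]_n => `|v (x + h)|%:E)); last 3 first.
    - apply/measurable_EFinP; apply: measurableT_comp => //.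
      under eq_fun do rewrite addrC.
      by apply: measurableT_comp => //; exact: measurable_shift.
    - by move=> h _; rewrite lee_fin.
    - by rewrite lee_fin.
    have J : (\int[lebesgue_rV n]_h `|v (h + x)|%:E = I)%E.
      by apply: (integral_shift x mnv) => y; rewrite lee_fin.
    by under eq_integral do rewrite addrC; rewrite J.
  rewrite (eq_integral _ _ (fun t _ => E t)) ge0_integralZr//; last first.
    exact/measurable_EFinP.
  by rewrite integral_indic// setIT lee_wpmul2r.
have Ifin : I \is a fin_num by rewrite ge0_fin_numE.
(* The bound is trivial for infinite [D] unless [L = 0]; that forces dimension 0, where [D] is an
   empty sum. *)
have [Doo|Dfin] := eqVneq D +oo%E.
  rewrite Doo; move: L0; rewrite le_eqVlt => /predU1P[L0|L0]; last first.
    by rewrite gt0_muley ?leey// lte_fin mulr_gt0.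
  have n0 : n = 0%N.
    apply/eqP; rewrite -leqn0 leqNgt; apply/negP => n0; move: LB.
    by rewrite -L0 expr0n gtn_eqF//= => /eqP; rewrite lt_eqF// mulr_gt0.
  exfalso; move: Doo; rewrite /D.
  move=> DD; suff : D = 0%E by rewrite /D DD.
  by rewrite /D; apply: big1 => i _; have := ltn_ord i; rewrite {2}n0.
have {Dfin} Dfin : D \is a fin_num by rewrite ge0_fin_numE// ltey.
(* As [I] is finite, [B * I] can be subtracted from both sides. *)
move: step1; rewrite -(fineK Ifin) -(fineK Dfin) -!EFinM -!EFinD !lee_fin => h.
rewrite -(ler_pM2l B0); nra.
Qed.

End poincare.

(** * Smooth truncations *)

Section flat_function.
Context {R : realType}.
Implicit Types (P : {poly R}) (s t : R).

(** This family of flat functions is closed under differentiation: the derivative of P(1/t)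
    exp(-1/t) is (P - P')(1/t) t^-2 exp(-1/t), again of this form with polynomial [dflat P].
    Smoothness then follows by induction on the order. *)
Definition flat P t : R := if 0 < t then P.[t^-1] * expR (- t^-1) else 0.

Definition dflat P : {poly R} := 'X^2 * (P - P^`()).

(** The inequality 1 + x <= exp x at x = s/k, raised to the power k. *)
Lemma exprn_expRN_le k s : 0 <= s -> s ^+ k * expR (- s) <= k%:R ^+ k.
Proof.
move=> s0; case: k => [|k].
  by rewrite !expr0 mul1r -expR0 ler_expR oppr_le0.
have k0 : 0 < k.+1%:R :> R by [].
have h : s / k.+1%:R <= expR (s / k.+1%:R).
  by rewrite (le_trans _ (expR_ge1Dx _))// lerDr.
rewrite expRN ler_pdivrMr ?expR_gt0//.
have -> : expR s = expR (s / k.+1%:R) ^+ k.+1.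
  by rewrite -expRM_natl; congr expR; field; rewrite gt_eqF//.
rewrite -exprMn; apply: lerXn2r; rewrite ?nnegrE ?mulr_ge0 ?expR_ge0//.
by rewrite mulrC -ler_pdivrMr.
Qed.

Lemma horner_expRN_bounded P :
  exists2 C, 0 <= C & forall s, 0 <= s -> `|P.[s] * expR (- s)| <= C.
Proof.
exists (\sum_(i < size P) `|P`_i| * i%:R ^+ i).
  by apply: sumr_ge0 => i _; rewrite mulr_ge0.
move=> s s0; rewrite horner_coef mulr_suml; apply: (le_trans (ler_norm_sum _ _ _)).
apply: ler_sum => i _; rewrite -mulrA normrM ler_wpM2l// ger0_norm.
  exact: exprn_expRN_le.
by rewrite mulr_ge0 ?expR_ge0// exprn_ge0.
Qed.

(** Boundedness is applied to ['X * P]: the extra factor 1/t is what yields the linear bound, and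
    hence continuity at 0. *)
Lemma flat_le_linear P : exists2 C, 0 <= C & forall t, `|flat P t| <= C * `|t|.
Proof.
have [C C0 PC] := horner_expRN_bounded ('X * P); exists C => // t.
rewrite /flat; case: ifPn => [t0|_]; last by rewrite normr0 mulr_ge0.
have tV : 0 <= t^-1 by rewrite invr_ge0 ltW.
have := PC t^-1 tV; rewrite hornerM hornerX -mulrA normrM.
by rewrite gtr0_norm ?invr_gt0// mulrC ler_pdivrMr// (gtr0_norm t0).
Qed.

Lemma flat_cvg0 P : flat P t @[t --> (0:R)] --> (0:R).
Proof.
have [C C0 PC] := flat_le_linear P.
apply/cvgr0Pnorm_le => e e0.
near=> t.
apply: (le_trans (PC t)).
have h : `|t| <= e / (C + 1).
  near: t; exists (e / (C + 1)); first by rewrite /= divr_gt0// ltr_wpDl.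
  by move=> y; rewrite /= sub0r normrN => /ltW.
apply: (@le_trans _ _ ((C + 1) * `|t|)); first by rewrite ler_wpM2r// lerDl.
by rewrite -ler_pdivlMl ?ltr_wpDl// mulrC.
Unshelve. all: by end_near. Qed.

Lemma is_derive_flat P t : is_derive t 1 (flat P) (flat (dflat P) t).
Proof.
have [t0|t0|->] := ltgtP t 0.
- rewrite {2}/flat ltNge ltW//=.
  apply: (@near_eq_is_derive _ _ _ (cst 0)) => //.
  near=> s; rewrite /flat ifF//; apply: negbTE; rewrite -leNgt ltW//.
  near: s; exact: lt_nbhsl.
- rewrite {2}/flat t0.
  pose g s := P.[s^-1] * expR (- s^-1).
  have dg : is_derive t 1 g ((dflat P).[t^-1] * expR (- t^-1)).
    have dV : is_derive t 1 (fun s : R => s^-1) (- t ^- 2 *: 1).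
      by apply: is_deriveV; rewrite gt_eqF.
    have dNV : is_derive t 1 (fun s : R => - s^-1) (- (- t ^- 2 *: 1)).
      exact: is_deriveN.
    have dP := is_derive1_comp (is_derive_poly P t^-1) dV.
    have de := @is_derive1_comp _ expR (fun s => - s^-1) t _ _ (is_derive_expR _) dNV.
    apply: (is_derive_eq (is_deriveM dP de)) => /=.
    rewrite /dflat !hornerE /GRing.scale/= exprVn.
    ring.
  apply: (near_eq_is_derive _ dg).
  near=> s; rewrite /flat ifT//.
  near: s; exact: lt_nbhsr.
- have cv : (fun h : R => h^-1 *: ((flat P \o shift 0) (h *: 1) - flat P 0)) @ 0^' --> (0:R).
    (* At 0 the difference quotient of [flat P] is itself a flat function, that of ['X * P], so it
       tends to 0. *)
    have E : {near 0^', (fun h : R => flat ('X * P) h) =1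
      (fun h : R => h^-1 *: ((flat P \o shift 0) (h *: 1) - flat P 0))}.
      near=> h; rewrite /flat/= addr0 /GRing.scale/= mulr1 ltxx subr0.
      by case: ifPn => h0; rewrite ?mulr0// hornerM hornerX mulrA.
    apply: (cvg_trans (near_eq_cvg E)).
    apply: (@cvg_within_filter _ _ _ (nbhs (0:R))).
    exact: flat_cvg0.
  have -> : flat (dflat P) 0 = 0 by rewrite /flat ltxx.
  apply: DeriveDef; first by apply/cvg_ex; exists 0.
  exact/cvg_lim.
Unshelve. all: by end_near. Qed.

Lemma derivable_flat P t : derivable (flat P) t 1.
Proof. by have [] := is_derive_flat P t. Qed.

Lemma derive1_flat P : (flat P)^`()%classic = flat (dflat P).
Proof. by apply/funext => t; rewrite derive1E; have [] := is_derive_flat P t. Qed.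

(** For t > 0 this is t exp(-1/t), with derivative (1 + 1/t) exp(-1/t). The latter lies in [0, 1]
    because 1 + x <= exp x, so the ramp is a smooth nondecreasing contraction. *)
Definition ramp t : R := t * flat 1 t.

Definition dramp : R -> R := flat (1 + 'X).

Lemma is_derive_ramp t : is_derive t 1 ramp (dramp t).
Proof.
have h : is_derive t 1 (fun s : R => s) 1 by exact: is_derive_id.
apply: (is_derive_eq (is_deriveM h (is_derive_flat 1 t))).
rewrite /dramp /flat; case: ifPn => [t0|_]; rewrite /GRing.scale/= ?mulr0 ?mul0r ?addr0//.
rewrite /dflat !hornerE derivC !hornerE /= subr0; field; rewrite gt_eqF//.
Qed.

Lemma dramp_ge0 t : 0 <= dramp t.
Proof.
rewrite /dramp /flat; case: ifPn => // t0.
by rewrite !hornerE mulr_ge0 ?expR_ge0// addr_ge0// invr_ge0 ltW.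
Qed.

Lemma dramp_le1 t : dramp t <= 1.
Proof.
rewrite /dramp /flat; case: ifPn => // t0.
by rewrite !hornerE expRN ler_pdivrMr ?expR_gt0// mul1r expR_ge1Dx.
Qed.

Lemma dramp_eq0 t : t <= 0 -> dramp t = 0.
Proof. by rewrite /dramp /flat leNgt => /negbTE ->. Qed.

Lemma ramp_eq0 t : t <= 0 -> ramp t = 0.
Proof. by rewrite /ramp /flat leNgt => /negbTE ->; rewrite mulr0. Qed.

Lemma ramp_ge t : 1 <= t -> expR (-1) <= ramp t.
Proof.
move=> t1; have t0 : 0 < t by exact: lt_le_trans t1.
rewrite /ramp /flat t0 hornerC mul1r -[leLHS]mul1r ler_pM// ?expR_ge0//.
by rewrite ler_expR lerN2 invf_le1.
Qed.

End flat_function.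

Section smooth.
Context {R : realType} {n : nat}.
Implicit Types (phi psi : 'rV[R]_n -> R) (f : R -> R).

Lemma Ck_continuous k phi : Ck k phi -> continuous phi.
Proof.
case: k => [//|k] [dphi _] x; exact: differentiable_continuous.
Qed.

Lemma Ck_lower k phi : Ck k.+1 phi -> Ck k phi.
Proof.
elim: k phi => [|k IH] phi; first exact: Ck_continuous.
by move=> [dphi Cphi]; split=> // i; apply: IH; exact: Cphi.
Qed.

Lemma partialD phi psi i : (forall x, differentiable phi x) ->
  (forall x, differentiable psi x) ->
  partial i (fun x => phi x + psi x) = (fun x => partial i phi x + partial i psi x).
Proof.
move=> dphi dpsi; apply/funext => x; rewrite /partial.
rewrite (_ : (fun x => phi x + psi x) = phi + psi)//.
by rewrite deriveD//; exact: diff_derivable.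
Qed.

Lemma partialM phi psi i : (forall x, differentiable phi x) ->
  (forall x, differentiable psi x) ->
  partial i (fun x => phi x * psi x) =
  (fun x => phi x * partial i psi x + psi x * partial i phi x).
Proof.
move=> dphi dpsi; apply/funext => x; rewrite /partial.
rewrite (_ : (fun x => phi x * psi x) = phi * psi)//.
by rewrite deriveM//; exact: diff_derivable.
Qed.

Lemma differentiable_compR f phi x : differentiable phi x ->
  derivable f (phi x) 1 -> differentiable (fun x => f (phi x)) x.
Proof.
move=> dphi /derivable1_diffP df.
exact: (differentiable_comp (f := phi) (g := f)).
Qed.

Lemma partial_comp f phi i x : differentiable phi x -> derivable f (phi x) 1 ->
  partial i (fun x => f (phi x)) x = f^`()%classic (phi x) * partial i phi x.
Proof.
move=> dphi df; have /derivable1_diffP df' := df.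
have dc := differentiable_compR dphi df.
rewrite /partial !deriveE//.
rewrite (diff_comp (f := phi) (g := f))//= diff1E//= mulrC.
by rewrite /GRing.scale/= mulrC.
Qed.

Lemma Ck_cst k (c : R) : Ck k (fun _ : 'rV[R]_n => c).
Proof.
elim: k c => [|k IH] c; first exact: cst_continuous.
split=> [x|i]; first exact: differentiable_cst.
rewrite (_ : partial i _ = fun=> 0); first exact: IH.
by apply/funext => x; rewrite /partial derive_cst.
Qed.

Lemma CkD k phi psi : Ck k phi -> Ck k psi -> Ck k (fun x => phi x + psi x).
Proof.
elim: k phi psi => [|k IH] phi psi.
  by move=> /= cphi cpsi x; apply: continuousD; [exact: cphi|exact: cpsi].
move=> [dphi Cphi] [dpsi Cpsi]; split=> [x|i].
  exact: differentiableD.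
by rewrite partialD//; apply: IH; [exact: Cphi|exact: Cpsi].
Qed.

Lemma CkM k phi psi : Ck k phi -> Ck k psi -> Ck k (fun x => phi x * psi x).
Proof.
elim: k phi psi => [|k IH] phi psi.
  by move=> /= cphi cpsi x; apply: continuousM; [exact: cphi|exact: cpsi].
move=> Cphi Cpsi; have := Ck_lower Cphi; have := Ck_lower Cpsi.
move: Cphi Cpsi => [dphi Cphi] [dpsi Cpsi] C1 C2; split=> [x|i].
  exact: differentiableM.
by rewrite partialM//; apply: CkD; apply: IH => //; [exact: Cpsi|exact: Cphi].
Qed.

Fixpoint CkR k f : Prop :=
  if k is k'.+1 then (forall t, derivable f t 1) /\ CkR k' (f^`()%classic)
  else continuous f.

Lemma CkR_continuous k f : CkR k f -> continuous f.
Proof.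
case: k => [//|k] [df _] t.
by apply/differentiable_continuous/derivable1_diffP.
Qed.

Lemma Ck_comp k f phi : CkR k f -> Ck k phi -> Ck k (fun x => f (phi x)).
Proof.
elim: k f phi => [|k IH] f phi.
  by move=> /= cf cphi x; apply: (@continuous_comp _ _ _ phi f); [exact: cphi|exact: cf].
move=> Cf Cphi; have := Ck_lower Cphi.
move: Cf Cphi => [df Cf] [dphi Cphi] C1; split=> [x|i].
  exact: differentiable_compR.
rewrite (_ : partial i _ = fun x => f^`()%classic (phi x) * partial i phi x).
  by apply: CkM; [exact: IH|exact: Cphi].
by apply/funext => x; rewrite partial_comp.
Qed.

Lemma CkR_flat k (P : {poly R}) : CkR k (flat P).
Proof.
elim: k P => [|k IH] P /=.
  move=> t; apply/differentiable_continuous/derivable1_diffP.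
  exact: derivable_flat.
split; first exact: derivable_flat.
by rewrite derive1_flat.
Qed.

Lemma derive1_ramp : (@ramp R)^`()%classic = dramp.
Proof. by apply/funext => t; rewrite derive1E; have [] := is_derive_ramp t. Qed.

Lemma CkR_ramp k : CkR k (@ramp R).
Proof.
case: k => [|k] /=.
  move=> t; apply/differentiable_continuous/derivable1_diffP.
  by have [] := is_derive_ramp t.
split; first by move=> t; have [] := is_derive_ramp t.
by rewrite derive1_ramp; exact: CkR_flat.
Qed.

End smooth.

Lemma ndivr_le0 {R : realType} (x s : R) : 0 < s -> x <= 0 -> x / s <= 0.
Proof. by move=> s0 x0; rewrite pmulr_lle0 ?invr_gt0. Qed.

Section truncation.
Context {R : realType}.
Variables (k s : R).

(* a smooth, odd substitute for [sgn t * max (`|t| - k) 0] *)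
Definition trunc (t : R) : R := s * ramp ((t - k) / s) - s * ramp ((- t - k) / s).

Definition dtrunc (t : R) : R := dramp ((t - k) / s) + dramp ((- t - k) / s).

Lemma is_derive_trunc (s0 : 0 < s) (t : R) : is_derive t (1 : R) trunc (dtrunc t).
Proof.
have hc (c : R) : is_derive t (1 : R) (cst c : R -> R) 0 by exact: is_derive_cst.
have hid : is_derive t (1 : R) (@id R) 1 by exact: is_derive_id.
have h1 : is_derive t (1 : R) (fun t : R => (t - k) / s) s^-1.
  apply: (is_derive_eq (is_deriveM (is_deriveB hid (hc k)) (hc s^-1))).
  by rewrite /GRing.scale/= mulr0 add0r subr0 mulr1.
have h2 : is_derive t (1 : R) (fun t : R => (- t - k) / s) (- s^-1).
  apply: (is_derive_eq (is_deriveM (is_deriveB (is_deriveN hid) (hc k)) (hc s^-1))).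
  by rewrite /GRing.scale/= mulr0 add0r subr0 mulrN1.
have c1 := @is_derive1_comp _ ramp (fun t => (t - k) / s) t _ _ (is_derive_ramp _) h1.
have c2 := @is_derive1_comp _ ramp (fun t => (- t - k) / s) t _ _ (is_derive_ramp _) h2.
have d1 := is_deriveZ s c1.
have d2 := is_deriveZ s c2.
apply: (is_derive_eq (is_deriveB d1 d2)).
by rewrite /GRing.scale/= /dtrunc; field; rewrite gt_eqF.
Qed.

Lemma derivable_trunc (s0 : 0 < s) (t : R) : derivable trunc t (1 : R).
Proof. by have [] := is_derive_trunc s0 t. Qed.

Lemma derive1_trunc (s0 : 0 < s) : trunc^`()%classic = dtrunc.
Proof. by apply/funext => t; rewrite derive1E; have [] := is_derive_trunc s0 t. Qed.

Lemma dtrunc_ge0 t : 0 <= dtrunc t.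
Proof. by rewrite addr_ge0// dramp_ge0. Qed.

(** Since [k > 0], at most one of the two ramps is active at a given [t]. *)
Lemma dtrunc_le1 (k0 : 0 < k) (s0 : 0 < s) t : dtrunc t <= 1.
Proof.
rewrite /dtrunc; have [t0|t0] := leP 0 t.
  rewrite [X in _ + X]dramp_eq0 ?addr0 ?dramp_le1//.
by apply: ndivr_le0 => //; lra.
rewrite [X in X + _]dramp_eq0 ?add0r ?dramp_le1//.
by apply: ndivr_le0 => //; lra.
Qed.

Lemma dtrunc_eq0 (s0 : 0 < s) t : `|t| <= k -> dtrunc t = 0.
Proof.
rewrite ler_norml => /andP[t1 t2].
by rewrite /dtrunc !dramp_eq0 ?addr0//; apply: ndivr_le0 => //; lra.
Qed.

Lemma trunc_eq0 (s0 : 0 < s) t : `|t| <= k -> trunc t = 0.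
Proof.
rewrite ler_norml => /andP[t1 t2].
by rewrite /trunc !ramp_eq0 ?mulr0 ?subr0//; apply: ndivr_le0 => //; lra.
Qed.

Lemma trunc_ge (k0 : 0 < k) (s0 : 0 < s) t : k + s <= `|t| -> s * expR (-1) <= `|trunc t|.
Proof.
have [t0|t0] := leP 0 t; [rewrite (ger0_norm t0)|rewrite (ltr0_norm t0)] => tk.
  rewrite /trunc [X in _ - s * X]ramp_eq0 ?mulr0 ?subr0; last first.
    by apply: ndivr_le0 => //; lra.
  apply: le_trans (ler_norm _); rewrite ler_pM2l//; apply: ramp_ge.
  by rewrite ler_pdivlMr// mul1r; lra.
rewrite /trunc [X in s * X - _]ramp_eq0 ?mulr0 ?sub0r ?normrN; last first.
  by apply: ndivr_le0 => //; lra.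
apply: le_trans (ler_norm _); rewrite ler_pM2l//; apply: ramp_ge.
by rewrite ler_pdivlMr// mul1r; lra.
Qed.

Lemma trunc_lip (k0 : 0 < k) (s0 : 0 < s) x y : `|trunc x - trunc y| <= `|x - y|.
Proof.
wlog xy : x y / x <= y.
  by move=> h; have [/h//|/ltW/h] := leP x y; rewrite distrC (distrC y).
have [||c _ E] := @MVT_segment R trunc dtrunc x y xy.
- by move=> t _; exact: (is_derive_trunc s0).
- apply: continuous_subspaceT => t.
  by apply/differentiable_continuous/derivable1_diffP; exact: (derivable_trunc s0).
rewrite distrC (distrC x) E normrM ler_piMl// ger0_norm ?dtrunc_ge0//.
exact: (dtrunc_le1 k0 s0).
Qed.

Lemma continuous_dtrunc : continuous dtrunc.
Proof.
move=> t; apply: cvgD.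
  apply: (@continuous_comp _ _ _ (fun t => (t - k) / s) dramp).
    apply: cvgMr_tmp; apply: cvgB; first exact: cvg_id.
    exact: cvg_cst.
  exact: (@CkR_continuous _ 0%N _ (CkR_flat 0 _)).
apply: (@continuous_comp _ _ _ (fun t => (- t - k) / s) dramp).
  apply: cvgMr_tmp; apply: cvgB; last exact: cvg_cst.
  by apply: cvgN; exact: cvg_id.
exact: (@CkR_continuous _ 0%N _ (CkR_flat 0 _)).
Qed.

Variable n : nat.
Implicit Types (Omega : set 'rV[R]_n) (phi : 'rV[R]_n -> R).

Lemma partial_trunc (s0 : 0 < s) phi i x : differentiable phi x ->
  partial i (fun x => trunc (phi x)) x = dtrunc (phi x) * partial i phi x.
Proof.
by move=> dphi; rewrite partial_comp ?(derive1_trunc s0)//; exact: (derivable_trunc s0).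
Qed.

Lemma test_function_trunc (k0 : 0 < k) (s0 : 0 < s) Omega phi : test_function Omega phi ->
  test_function Omega (fun x => trunc (phi x)).
Proof.
move=> [Cphi cphi sphi].
have sub : Defs.support (fun x => trunc (phi x)) `<=` Defs.support phi.
  apply: closure_subset => x /=; apply: contra => /eqP ->.
  by rewrite (trunc_eq0 s0)// normr0 ltW.
split.
- move=> j; rewrite /trunc; apply: CkD.
    apply: CkM; first exact: Ck_cst.
    apply: Ck_comp; first exact: CkR_ramp.
    by apply: CkM; [apply: CkD => //; exact: Ck_cst|exact: Ck_cst].
  under eq_fun do rewrite -mulNr.
  apply: CkM; first exact: Ck_cst.
  apply: Ck_comp; first exact: CkR_ramp.
  apply: CkM; last exact: Ck_cst.
  apply: CkD; last exact: Ck_cst.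
  under eq_fun do rewrite -mulN1r.
  by apply: CkM => //; exact: Ck_cst.
- by apply: subclosed_compact cphi sub; exact: closed_closure.
- exact: subset_trans sub sphi.
Qed.

End truncation.

(** * The vector field *)

Section power_growth.
Context {R : realType}.

(** The function phi(t) - K t^e has nonnegative derivative on ]0, 1[. The mean value theorem asks
    for differentiability in the open interval only, so a derivative that is singular at t = 0, as
    for e < 1, is harmless. *)
Lemma power_growth (phi dphi : R -> R) (K e : R) : 0 < e ->
  continuous phi ->
  (forall t : R, 0 < t < 1 -> is_derive t (1 : R) phi (dphi t)) ->
  (forall t : R, 0 < t < 1 -> K * (e * t `^ (e - 1)) <= dphi t) ->
  K <= phi 1 - phi 0.
Proof.
move=> e0 cphi dphiP dphiK.
pose g (t : R) := phi t - K * t `^ e.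
have dg (t : R) : 0 < t < 1 -> is_derive t (1 : R) g (dphi t - K * (e * t `^ (e - 1))).
  move=> t01; have t0 : 0 < t by case/andP: t01.
  exact: (is_deriveB (dphiP t t01) (is_deriveZ K (is_derive1_powR e t0))).
have dgI (t : R) : t \in `]0, 1[ ->
    is_derive t (1 : R) g (dphi t - K * (e * t `^ (e - 1))).
  by rewrite in_itv; exact: dg.
have cg : {within `[0, 1], continuous g}.
  apply/(continuous_within_itvP _ ltr01); split.
  - move=> t t01; apply/differentiable_continuous/derivable1_diffP.
    by rewrite in_itv in t01; have [] := dg t t01.
  - rewrite /g powR0 ?gt_eqF// mulr0 subr0 -[X in _ --> X]subr0.
    apply: cvgB; first by apply: cvg_at_right_filter; exact: cphi.
    rewrite [X in _ --> X](_ : _ = K * 0); last by rewrite mulr0.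
    by apply: cvgMl_tmp; exact: powR_cvg0.
  - apply: cvg_at_left_filter; apply: cvgB; first exact: cphi.
    apply: cvgMl_tmp.
    have c1 : {for (1:R), continuous (fun t : R => t `^ e)}.
      apply/differentiable_continuous/derivable1_diffP.
      by have [] := is_derive1_powR e (@ltr01 R).
    exact: c1.
have [c c01 E] := MVT ltr01 dgI cg.
have : 0 <= g 1 - g 0.
  rewrite E subr0 mulr1 subr_ge0; apply: dphiK.
  by rewrite in_itv in c01.
by rewrite /g powR1 powR0 ?gt_eqF// mulr0 subr0 mulr1; lra.
Qed.

End power_growth.

Section structure.
Context {R : realType} {n : nat}.
Implicit Types (x z xi : 'rV[R]_n).

Lemma dot_ge0 z : 0 <= dot z z.
Proof. by apply: sumr_ge0 => i _; rewrite -expr2 sqr_ge0. Qed.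

Lemma enorm_ge0 z : 0 <= enorm z.
Proof. exact: sqrtr_ge0. Qed.

Lemma enorm0 : enorm (0 : 'rV[R]_n) = 0.
Proof.
by rewrite /enorm /dot big1 ?sqrtr0// => i _; rewrite mxE mul0r.
Qed.

Lemma enorm_gt0 z : z != 0 -> 0 < enorm z.
Proof.
move=> z0; rewrite sqrtr_gt0 lt_neqAle dot_ge0 andbT eq_sym.
apply: contra z0 => /eqP h; apply/eqP/rowP => i; rewrite mxE.
have /psumr_eq0P : \sum_i z ord0 i * z ord0 i = 0 by [].
move=> /(_ (fun i _ => ltac:(by rewrite -expr2 sqr_ge0))) /(_ i isT) /eqP.
by rewrite mulf_eq0 orbb => /eqP.
Qed.

Lemma coord_le_enorm z i : `|z ord0 i| <= enorm z.
Proof.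
rewrite -sqrtr_sqr ler_wsqrtr// /dot (bigD1 i)//= -expr2 lerDl.
by apply: sumr_ge0 => j _; rewrite -expr2 sqr_ge0.
Qed.

Lemma enormZ (t : R) z : 0 <= t -> enorm (t *: z) = t * enorm z.
Proof.
move=> t0; rewrite /enorm (_ : dot _ _ = t ^+ 2 * dot z z).
  by rewrite sqrtrM ?sqr_ge0// sqrtr_sqr ger0_norm.
by rewrite /dot mulr_sumr; apply: eq_bigr => i _; rewrite !mxE; ring.
Qed.

Variables (Omega : set 'rV[R]_n) (p : R) (a : 'rV[R]_n -> 'rV[R]_n -> 'rV[R]_n).

Lemma continuous_field x : structure_conditions Omega p a -> Omega x ->
  continuous (a x).
Proof.
move=> [ca _ _ _ _] Ox z.
have Cx : closure Omega x by exact: subset_closure.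
have : {within closure Omega `*` setT, continuous (fun y => a y.1 y.2)} := ca.
move=> /(_ (x, z)) => h.
have h' : (fun y => a y.1 y.2) @ within (closure Omega `*` setT) (nbhs (x, z)) --> a x z.
  move: h; rewrite /continuous_at/= nbhs_subspace_in//.
apply: cvg_trans h'.
(* The slice over [x] lies inside the subset, so the restriction expressed by [within] disappears on
   it. *)
apply: (@cvg_comp _ _ _ (fun z => (x, z)) (fun y => a y.1 y.2) (nbhs z)
   (within (closure Omega `*` setT) (nbhs (x, z)))) => //.
move=> U /= [[A B] /= [Ax Bz] AB]; apply: filterS Bz => y By /=.
by apply: AB => //; split => //; exact: nbhs_singleton Ax.
Qed.

Lemma differentiable_field x z : structure_conditions Omega p a -> Omega x ->
  z != 0 -> differentiable (a x) z.
Proof.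
move=> [_ [dA _] _ _ _] Ox z0.
have := dA x z Ox z0; set A := fun y => _ => dAx.
rewrite (_ : a x = A \o (fun z => (x, z)))//.
apply: differentiable_comp => //.
Qed.

Lemma is_derive_ray x z i (t : R) : structure_conditions Omega p a -> Omega x ->
  z != 0 -> 0 < t ->
  is_derive t (1 : R) (fun t : R => a x (t *: z) ord0 i)
    (('d (a x) (t *: z) z) ord0 i).
Proof.
move=> ha Ox z0 t0.
have tz0 : t *: z != 0 by rewrite scaler_eq0 negb_or gt_eqF.
have da := differentiable_field ha Ox tz0.
(* The ray is written as a line through 0 to match the form of [derive_line]. *)
pose F (t : R) := a x (0 + t *: z).
have dF : derivable F t 1.
  apply: derivable_line; rewrite add0r; exact: diff_derivable.
have DF : 'D_1 F t = 'd (a x) (t *: z) z.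
  by rewrite derive_line add0r deriveE.
rewrite (_ : (fun t : R => a x (t *: z) ord0 i) = fun t : R => F t ord0 i).
  apply: DeriveDef; first by have /derivable_mxP := dF; exact.
  by rewrite -DF derive_mx// mxE.
by apply/funext => s; rewrite /F add0r.
Qed.

Lemma continuous_ray x z i : structure_conditions Omega p a -> Omega x ->
  continuous (fun t : R => a x (t *: z) ord0 i).
Proof.
move=> ha Ox t.
have c1 : {for t, continuous (fun t : R => t *: z)}.
  by apply: cvgZr_tmp; exact: cvg_id.
have c2 := continuous_field ha Ox.
have c3 : {for t, continuous (fun t : R => a x (t *: z))}.
  exact: (continuous_comp c1 (c2 _)).
apply: (@continuous_comp _ _ _ (fun t : R => a x (t *: z))
  (fun M : 'rV[R]_n => M ord0 i)) => //.
exact: coord_continuous.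
Qed.

(** Along the ray the derivative of <a(x,tz), z> is at least (p-1) t^(p-2) |z|^p. The factor p-1 of
    the ellipticity condition is the exponent e = p-1 of [power_growth], whence the constant 1. *)
Lemma structure_coercive x z : 1 < p -> structure_conditions Omega p a ->
  Omega x -> enorm z `^ p <= dot (a x z) z.
Proof.
move=> p1 ha Ox; have [ca C1a a0 lo [C C0 up]] := ha.
have [->|z0] := eqVneq z 0.
  by rewrite enorm0 powR0 ?gt_eqF ?(lt_trans ltr01)// a0// /dot big1// => i _; rewrite mxE mul0r.
have N0 := enorm_gt0 z0.
pose phi (t : R) := dot (a x (t *: z)) z.
have -> : dot (a x z) z = phi 1 - phi 0.
  rewrite /phi scale1r scale0r a0//.
  by rewrite [X in _ - X]big1 ?subr0// => i _; rewrite mxE mul0r.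
apply: (@power_growth _ phi (fun t => dot ('d (a x) (t *: z) z) z) _ (p - 1)).
- by rewrite subr_gt0.
- apply: (continuous_big (op := +%R)); first exact: add_continuous.
  by move=> i _ t; apply: cvgMr_tmp; exact: continuous_ray.
- move=> t /andP[t0 t1].
  rewrite /phi /dot.
  have -> : (fun t : R => \sum_i a x (t *: z) ord0 i * z ord0 i) =
     \sum_i (fun t : R => a x (t *: z) ord0 i * z ord0 i).
    by apply/funext => s; rewrite fct_sumE.
  apply: is_derive_sum => i.
  have h := is_derive_ray i ha Ox z0 t0.
  have hc : is_derive t (1 : R) (cst (z ord0 i) : R -> R) 0 by exact: is_derive_cst.
  apply: (is_derive_eq (is_deriveM h hc)).
  by rewrite /GRing.scale/= mulr0 add0r mulrC.
move=> t /andP[t0 t1].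
have tz0 : t *: z != 0 by rewrite scaler_eq0 negb_or gt_eqF.
apply: le_trans (lo x (t *: z) z Ox tz0).
rewrite (enormZ _ (ltW t0)) (powRM _ (ltW t0) (ltW N0)) le_eqVlt; apply/orP; left; apply/eqP.
have -> : enorm z `^ p = enorm z `^ (p - 2) * enorm z ^+ 2.
  rewrite -powR_mulrn ?ltW// -powRD ?subrK//.
  by apply/implyP => _; rewrite gt_eqF.
by rewrite (_ : p - 1 - 1 = p - 2); [ring|ring].
Qed.

Lemma structure_growth : 1 < p -> structure_conditions Omega p a ->
  exists2 C : R, 0 <= C & forall x z i, Omega x ->
    `|a x z ord0 i| <= C * enorm z `^ (p - 1).
Proof.
move=> p1 ha; have [ca C1a a0 lo [C C0 up]] := ha.
have p10 : 0 < p - 1 by rewrite subr_gt0.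
(* The division by p-1 comes from integrating t^(p-2) over [0, 1]. *)
exists (C / (p - 1)); first by rewrite divr_ge0// ltW.
move=> x z i Ox.
have [->|z0] := eqVneq z 0.
  by rewrite a0// mxE normr0 mulr_ge0 ?powR_ge0// divr_ge0// ltW.
have N0 := enorm_gt0 z0.
pose phi (t : R) := a x (t *: z) ord0 i.
pose dphi (t : R) := ('d (a x) (t *: z) z) ord0 i.
have bound (t : R) : 0 < t -> `|dphi t| <= C / (p - 1) * enorm z `^ (p - 1) * ((p - 1) * t `^ (p - 1 - 1)).
  move=> t0; have tz0 : t *: z != 0 by rewrite scaler_eq0 negb_or gt_eqF.
  apply: (le_trans (coord_le_enorm _ i)); apply: (le_trans (up x _ _ Ox tz0)).
  rewrite (enormZ _ (ltW t0)) (powRM _ (ltW t0) (ltW N0)) le_eqVlt; apply/orP; left; apply/eqP.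
  have -> : enorm z `^ (p - 1) = enorm z `^ (p - 2) * enorm z.
    rewrite -{3}(powRr1 (ltW N0)) -powRD; first by congr powR; ring.
    by apply/implyP => _; rewrite gt_eqF.
  by rewrite (_ : p - 1 - 1 = p - 2); [field; rewrite gt_eqF|ring].
have E : a x z ord0 i = phi 1 - phi 0.
  by rewrite /phi scale1r scale0r a0// mxE subr0.
rewrite E ler_norml; apply/andP; split.
  apply: (@power_growth _ phi dphi _ (p - 1)) => //.
  - exact: continuous_ray.
  - by move=> t /andP[t0 _]; exact: is_derive_ray.
  - move=> t /andP[t0 _]; have := bound t t0; rewrite ler_norml => /andP[h _].
    by rewrite mulNr.
(* The upper bound is the lower bound for [- phi]. *)
rewrite -lerN2 opprB.
have -> : phi 0 - phi 1 = (fun t => - phi t) 1 - (fun t => - phi t) 0 by rewrite /=; ring.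
apply: (@power_growth _ (fun t => - phi t) (fun t => - dphi t) _ (p - 1)) => //.
- by move=> t; apply: cvgN; exact: continuous_ray.
- by move=> t /andP[t0 _]; apply: is_deriveN; exact: is_derive_ray.
- move=> t /andP[t0 _]; have := bound t t0; rewrite ler_norml => /andP[_ h].
  by rewrite mulNr lerN2.
Qed.

End structure.

(** * Approximation by test functions *)

Section real_integrals.
Context d (T : measurableType d) (R : realType).
Variables (mu : {measure set T -> \bar R}) (D : set T).
Hypothesis mD : measurable D.
Implicit Types u v : T -> R.

Lemma ge0_le_integralE u v : measurable_fun D u -> measurable_fun D v ->
  (forall x, D x -> 0 <= u x <= v x) ->
  (\int[mu]_(x in D) (u x)%:E <= \int[mu]_(x in D) (v x)%:E)%E.
Proof.
move=> mu' mv uv; apply: ge0_le_integral => //.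
- by move=> x Dx; rewrite lee_fin; case/andP: (uv x Dx).
- exact/measurable_EFinP.
- exact/measurable_EFinP.
- by move=> x Dx; rewrite lee_fin; case/andP: (uv x Dx).
Qed.

Lemma ge0_integralDE u v : measurable_fun D u -> measurable_fun D v ->
  (forall x, D x -> 0 <= u x) -> (forall x, D x -> 0 <= v x) ->
  (\int[mu]_(x in D) (u x + v x)%:E =
   \int[mu]_(x in D) (u x)%:E + \int[mu]_(x in D) (v x)%:E)%E.
Proof.
move=> mu' mv u0 v0; under eq_integral do rewrite EFinD.
by rewrite ge0_integralD//; exact/measurable_EFinP.
Qed.

Lemma ge0_integralZlE (c : R) u : measurable_fun D u -> 0 <= c ->
  (forall x, D x -> 0 <= u x) ->
  (\int[mu]_(x in D) (c * u x)%:E = c%:E * \int[mu]_(x in D) (u x)%:E)%E.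
Proof.
move=> mu' c0 u0; under eq_integral do rewrite EFinM.
by rewrite ge0_integralZl ?lee_fin//; exact/measurable_EFinP.
Qed.

Lemma ge0_integral_sumE m (u : 'I_m -> T -> R) :
  (forall i, measurable_fun D (u i)) ->
  (forall i x, D x -> 0 <= u i x) ->
  (\int[mu]_(x in D) (\sum_i u i x)%:E =
   \sum_i \int[mu]_(x in D) (u i x)%:E)%E.
Proof.
move=> mu' u0; under eq_integral do rewrite -sumEFin.
by rewrite ge0_integral_sum// => i; exact/measurable_EFinP.
Qed.

Lemma ge0_integral_setE u (A : set T) c : measurable A -> A `<=` D -> 0 <= c ->
  measurable_fun D u ->
  (forall x, D x -> 0 <= u x) -> (forall x, A x -> c <= u x) ->
  (c%:E * mu A <= \int[mu]_(x in D) (u x)%:E)%E.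
Proof.
move=> mA AD c0 mu' u0 uc; rewrite -integral_cst//.
apply: (@le_trans _ _ (\int[mu]_(x in A) (u x)%:E)%E).
  apply: ge0_le_integral => //.
  by apply/measurable_EFinP; exact: measurable_funS mu'.
apply: ge0_subset_integral => //; first exact/measurable_EFinP.
Qed.

Lemma integrable_bound u v : measurable_fun D u -> measurable_fun D v ->
  (forall x, D x -> `|u x| <= v x) ->
  (\int[mu]_(x in D) (v x)%:E < +oo)%E -> mu.-integrable D (EFin \o u).
Proof.
move=> mu' mv uv voo; apply/integrableP; split; first exact/measurable_EFinP.
apply: le_lt_trans voo; apply: ge0_le_integralE => //.
  exact: measurableT_comp.
by move=> x Dx; rewrite normr_ge0 uv.
Qed.

End real_integrals.

Section young.
Context {R : realType}.

(** A form of Young's inequality without sharp constants: the first term dominates if y <= e x, the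
    second if x < y/e. *)
Lemma young_pow (p x y e : R) : 1 < p -> 0 <= x -> 0 <= y -> 0 < e ->
  x `^ (p - 1) * y <= e * x `^ p + e `^ (1 - p) * y `^ p.
Proof.
move=> p1 x0 y0 e0; have p0 : 0 < p by rewrite (lt_trans ltr01).
have [yx|xy] := leP y (e * x).
  rewrite (@le_trans _ _ (e * x `^ p))//; last first.
    by rewrite lerDl mulr_ge0// powR_ge0.
  rewrite -(mulr_powRB1 x0 p0) mulrA mulrC ler_wpM2r// powR_ge0//.
rewrite (@le_trans _ _ (e `^ (1 - p) * y `^ p))//; last first.
  by rewrite lerDr mulr_ge0 ?powR_ge0// ltW.
rewrite -(mulr_powRB1 y0 p0) [y * _ `^ _]mulrC mulrA ler_wpM2r//.
have -> : e `^ (1 - p) * y `^ (p - 1) = (y / e) `^ (p - 1).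
  rewrite powRM ?invr_ge0 ?(ltW e0)// mulrC -powR_inv1 ?(ltW e0)//.
  by rewrite -powRrM mulN1r opprB.
rewrite ge0_ler_powR ?nnegrE ?subr_ge0 ?(ltW p1) ?divr_ge0 ?(ltW e0)//.
by rewrite ler_pdivlMr// mulrC ltW.
Qed.

Lemma young1 (p y e : R) : 1 < p -> 0 <= y -> 0 < e ->
  y <= e + e `^ (1 - p) * y `^ p.
Proof.
by move=> p1 y0 e0; have := young_pow p1 ler01 y0 e0; rewrite !powR1 mul1r mulr1.
Qed.

(** This stands in for Holder's inequality: against a fixed function with finite p-th power
    integral, a small p-th power integral gives a small pairing. *)
Lemma young_integral d (T : measurableType d) (mu : {measure set T -> \bar R})
    (D : set T) (p : R) (x : T -> R) (eta : R) :
  1 < p -> measurable D -> measurable_fun D x -> (forall t, 0 <= x t) ->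
  (\int[mu]_(t in D) (x t `^ p)%:E < +oo)%E -> 0 < eta ->
  exists2 e, 0 < e & forall y : T -> R, measurable_fun D y ->
    (forall t, 0 <= y t) -> (\int[mu]_(t in D) (y t `^ p)%:E <= e%:E)%E ->
    (\int[mu]_(t in D) (x t `^ (p - 1) * y t)%:E <= eta%:E)%E.
Proof.
move=> p1 mD mx x0 xoo eta0; set X := (\int[mu]_(t in D) _)%E in xoo.
have X0 : (0 <= X)%E by apply: integral_ge0 => t _; rewrite lee_fin powR_ge0.
have Xf : X \is a fin_num by rewrite ge0_fin_numE.
have fX0 : 0 <= fine X by rewrite fine_ge0.
(* This [e] bounds the first Young term by [eta / 2]; the witness given next bounds the second one.
   The [+ 1] avoids a division by zero. *)
pose e := eta / 2 / (fine X + 1).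
have e0 : 0 < e by rewrite !divr_gt0// ltr_wpDl.
have c0 : 0 < e `^ (1 - p) by rewrite powR_gt0.
exists (eta / 2 / e `^ (1 - p)); first by rewrite !divr_gt0.
move=> y my y0 ye.
have mpow (q : R) (u : T -> R) : measurable_fun D u -> measurable_fun D (fun t => u t `^ q).
  by move=> mu'; exact: measurableT_comp (measurable_powR q) mu'.
apply: (@le_trans _ _ (\int[mu]_(t in D) (e * x t `^ p + e `^ (1 - p) * y t `^ p)%:E)%E).
  apply: ge0_le_integralE => //.
  - by apply: measurable_funM => //; exact: mpow.
  - by apply: measurable_funD; apply: measurable_funM => //; exact: mpow.
  - by move=> t Dt; rewrite mulr_ge0 ?powR_ge0//= young_pow.
rewrite ge0_integralDE//; last 4 first.
- by apply: measurable_funM => //; exact: mpow.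
- by apply: measurable_funM => //; exact: mpow.
- by move=> t _; rewrite mulr_ge0 ?powR_ge0// ltW.
- by move=> t _; rewrite mulr_ge0 ?powR_ge0.
rewrite !ge0_integralZlE ?(ltW e0) ?(ltW c0)//; try exact: mpow.
all: try by move=> t _; rewrite powR_ge0.
rewrite (splitr eta) EFinD; apply: leeD.
  rewrite -/X -(fineK Xf) -EFinM lee_fin /e -(mulrA (eta / 2)).
  apply: ler_piMr; first by rewrite divr_ge0// ltW.
  by rewrite mulrC ler_pdivrMr ?ltr_wpDl// mul1r lerDl.
have -> : ((eta / 2)%:E = (e `^ (1 - p))%:E * (eta / 2 / e `^ (1 - p))%:E)%E.
  by rewrite -EFinM; congr EFin; field; rewrite gt_eqF.
by apply: lee_wpmul2l => //; rewrite lee_fin ltW.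
Qed.

End young.

Section Lp_facts.
Context {R : realType} {n : nat}.
Implicit Types (Omega : set 'rV[R]_n) (u w phi : 'rV[R]_n -> R).

Lemma bounded_lebesgue_rV_lty Omega : measurable Omega -> bounded_set Omega ->
  (lebesgue_rV n Omega < +oo)%E.
Proof.
move=> mO [M [_ /(_ (`|M| + 1))]] h.
have M0 : 0 < `|M| + 1 by rewrite ltr_wpDl.
have {}h := h (le_lt_trans (ler_norm M) (ltr_pwDr ltr01 (lexx _))).
set K := `|M| + 1 in h M0.
have E := @lebesgue_rV_box R n (fun=> `[- K, K]%classic) (fun=> measurable_itv `[- K, K]).
apply: (@le_lt_trans _ _ (lebesgue_rV n [set x | forall i, `[- K, K]%classic (x ord0 i)])).
  apply: le_measure; rewrite ?inE//.
    exact: (@measurable_box R n (fun=> `[- K, K]%classic) (fun=> measurable_itv `[- K, K])).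
  move=> x Ox i; have := h x Ox; rewrite /= in_itv/= -ler_norml.
  apply: le_trans; rewrite [leRHS]/Num.Def.normr/= mx_normrE.
  exact: (le_bigmax _ _ (ord0, i)).
rewrite [X in (X < _)%E]E.
have I : lebesgue_measure (`[- K, K]%classic : set (measurableTypeR R)) = (K + K)%:E.
  rewrite lebesgue_measure_itv/= lte_fin ifT; last by lra.
  by rewrite -EFinB opprK.
under eq_bigr do rewrite I.
by rewrite prodEFin ltry.
Qed.

Lemma LnormOn_powR Omega (s : R) u : 0 < s ->
  (LnormOn Omega s%:E u `^ s = \int[lebesgue_rV n]_(x in Omega) (`|u x| `^ s)%:E)%E.
Proof.
move=> s0; rewrite /LnormOn powR_Lnorm ?gt_eqF// [RHS]integral_mkcond.
apply: eq_integral => x _; rewrite /= patchE patchE.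
by case: ifPn => // _; rewrite normr0 powR0// gt_eqF.
Qed.

Lemma LnormOn_cvg0 Omega (s : R) (u : nat -> 'rV[R]_n -> R) (e : R) :
  0 < s -> 0 < e -> (fun k => LnormOn Omega s%:E (u k)) @ \oo --> 0%E ->
  \forall k \near \oo,
    (\int[lebesgue_rV n]_(x in Omega) (`|u k x| `^ s)%:E <= e%:E)%E.
Proof.
move=> s0 e0 u0; have es : 0 < e `^ s^-1 by rewrite powR_gt0.
have : \forall k \near \oo, (LnormOn Omega s%:E (u k) < (e `^ s^-1)%:E)%E.
  apply: (u0 [set y | (y < (e `^ s^-1)%:E)%E]).
  by apply: open_ereal_lt'; rewrite lte_fin.
apply: filterS => k h; rewrite -LnormOn_powR//.
have -> : e%:E = ((e `^ s^-1)%:E `^ s)%E.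
  by rewrite poweR_EFin -powRrM mulVf ?gt_eqF// powRr1// ltW.
apply: gt0_ler_poweR (ltW h); rewrite ?in_itv/= ?leey ?andbT//.
- exact: ltW.
- exact: Lnorm_ge0.
- by rewrite lee_fin ltW.
Qed.

(** Some coordinate has modulus at least |z|/n, since otherwise the squares of the coordinates would
    add up to less than |z|^2. The crude constant is enough to deduce finiteness of integrals. *)
Lemma enorm_powR_le (p : R) (z : 'rV[R]_n) : 0 < p ->
  enorm z `^ p <= n%:R `^ p * \sum_i `|z ord0 i| `^ p.
Proof.
move=> p0; have [->|z0] := eqVneq z 0.
  by rewrite enorm0 powR0 ?gt_eqF// mulr_ge0 ?powR_ge0// sumr_ge0// => i _; rewrite powR_ge0.
have [i zi] : exists i, enorm z <= n%:R * `|z ord0 i|.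
  apply: contrapT => hn.
  have h i : n%:R * `|z ord0 i| < enorm z.
    by rewrite ltNge; apply/negP => hi; apply: hn; exists i.
  have n0 : (0 < n)%N.
    rewrite lt0n; apply: contra z0 => /eqP n0; apply/eqP/rowP => i.
    by have := ltn_ord i; rewrite {2}n0.
  have : dot z z < dot z z; last by rewrite ltxx.
  have E : dot z z = enorm z ^+ 2 by rewrite /enorm sqr_sqrtr// dot_ge0.
  have : \sum_i z ord0 i * z ord0 i < \sum_(i < n) (enorm z ^+ 2 / n%:R).
    apply: ltr_sum; first by apply/hasP; exists (Ordinal n0) => //; rewrite mem_index_enum.
    move=> i _; have hi := h i.
    have nR : 1 <= n%:R :> R by rewrite ler1n.
    rewrite -expr2 -real_normK ?num_real// ltr_pdivlMr ?ltr0n//.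
    rewrite (@le_lt_trans _ _ ((n%:R * `|z ord0 i|) ^+ 2))//.
      rewrite exprMn mulrC ler_wpM2r ?sqr_ge0// expr2.
      by rewrite ler_peMl// (le_trans ler01).
    by rewrite ltrXn2r// ?nnegrE ?enorm_ge0// mulr_ge0.
  rewrite sumr_const card_ord -(mulr_natr (enorm z ^+ 2 / n%:R)) divfK ?gt_eqF ?ltr0n//.
  by rewrite -E.
rewrite (@le_trans _ _ ((n%:R * `|z ord0 i|) `^ p))//.
  by apply: ge0_ler_powR => //; rewrite ?nnegrE ?enorm_ge0 ?mulr_ge0// ltW.
rewrite powRM// ler_wpM2l ?powR_ge0// (bigD1 i)//= lerDl.
by apply: sumr_ge0 => j _; rewrite powR_ge0.
Qed.

Lemma measurable_powRn (D : set 'rV[R]_n) (q : R) u :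
  measurable_fun D u -> measurable_fun D (fun t => u t `^ q).
Proof. by move=> mu; exact: measurableT_comp (measurable_powR q) mu. Qed.

Lemma measurable_enorm (D : set 'rV[R]_n) (g : 'rV[R]_n -> 'rV[R]_n) :
  (forall i, measurable_fun D (fun x => g x ord0 i)) ->
  measurable_fun D (fun x => enorm (g x)).
Proof.
move=> mg.
rewrite (_ : (fun x => _) = Num.sqrt \o (fun x => dot (g x) (g x)))//.
apply: measurableT_comp.
  exact: continuous_measurable_fun (@sqrt_continuous R).
apply: measurable_sum => i; exact: measurable_funM.
Qed.

Lemma enorm_Lp_lty Omega (p : R) (g : 'rV[R]_n -> 'rV[R]_n) : 0 < p ->
  measurable Omega -> (forall i, in_Lp Omega p (fun x => g x ord0 i)) ->
  (\int[lebesgue_rV n]_(x in Omega) (enorm (g x) `^ p)%:E < +oo)%E.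
Proof.
move=> p0 mO gLp.
have mg i : measurable_fun Omega (fun x => g x ord0 i) by have [] := gLp i.
have mX := measurable_enorm mg.
have mgp i : measurable_fun Omega (fun x => `|g x ord0 i| `^ p).
  by apply: measurable_powRn; exact: measurableT_comp.
apply: (@le_lt_trans _ _ (\int[lebesgue_rV n]_(x in Omega)
    (n%:R `^ p * \sum_i `|g x ord0 i| `^ p)%:E)%E).
  apply: ge0_le_integralE => //.
  - exact: measurable_powRn.
  - by apply: measurable_funM => //; exact: measurable_sum.
  - by move=> x _; rewrite powR_ge0 enorm_powR_le.
rewrite ge0_integralZlE ?powR_ge0//; last 2 first.
- exact: measurable_sum.
- by move=> x _; apply: sumr_ge0 => i _; rewrite powR_ge0.
rewrite ge0_integral_sumE//.
apply: lte_mul_pinfty => //; rewrite ?lee_fin ?powR_ge0//.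
apply: lte_sum_pinfty => i _; rewrite -LnormOn_powR//.
by apply: poweR_lty; have [] := gLp i.
Qed.

(** The weight |g|^(p-1) in the last estimate is the growth rate of a(x, g): it controls the error
    of replacing the gradient of phi by g in the equation. *)
Lemma W1p0_approx Omega (p : R) w g (eta : R) : 1 < p ->
  measurable Omega -> (lebesgue_rV n Omega < +oo)%E ->
  W1p0 Omega p w g -> 0 < eta ->
  exists phi, [/\ test_function Omega phi,
    (\int[lebesgue_rV n]_(x in Omega) (`|phi x - w x|)%:E <= eta%:E)%E,
    forall i, (\int[lebesgue_rV n]_(x in Omega)
      (`|partial i phi x - g x ord0 i|)%:E <= eta%:E)%E
  & forall i, (\int[lebesgue_rV n]_(x in Omega)
      (enorm (g x) `^ (p - 1) * `|partial i phi x - g x ord0 i|)%:E <= eta%:E)%E].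
Proof.
move=> p1 mO Ooo [[[mw woo] gLp _] [phi [tphi wphi gphi]]] eta0.
have p0 : 0 < p by rewrite (lt_trans ltr01).
have mg i : measurable_fun Omega (fun x => g x ord0 i) by have [] := gLp i.
have mX := measurable_enorm mg.
(* Pairing with the constant 1, admissible because [Omega] has finite measure, turns L^p smallness
   into L^1 smallness. *)
have [e1 e10 he1] : exists2 e : R, 0 < e & forall y : 'rV[R]_n -> R, measurable_fun Omega y ->
    (forall t, 0 <= y t) -> (\int[lebesgue_rV n]_(t in Omega) (y t `^ p)%:E <= e%:E)%E ->
    (\int[lebesgue_rV n]_(t in Omega) (y t)%:E <= eta%:E)%E.
  have [] := @young_integral R _ _ (lebesgue_rV n) Omega p (cst 1) eta p1 mO.
  - exact: measurable_cst.
  - by move=> t; rewrite ler01.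
  - by under eq_integral do rewrite powR1; rewrite integral_cst// mul1e.
  - exact: eta0.
  move=> e e0 h; exists e => // y my y0 hy.
  have := h y my y0 hy.
  by under eq_integral do rewrite powR1 mul1r.
have [e2 e20 he2] : exists2 e : R, 0 < e & forall y : 'rV[R]_n -> R, measurable_fun Omega y ->
    (forall t, 0 <= y t) -> (\int[lebesgue_rV n]_(t in Omega) (y t `^ p)%:E <= e%:E)%E ->
    (\int[lebesgue_rV n]_(t in Omega) (enorm (g t) `^ (p - 1) * y t)%:E <= eta%:E)%E.
  apply: young_integral => //; first by move=> t; exact: enorm_ge0.
  exact: enorm_Lp_lty p0 mO gLp.
have e0 : 0 < Num.min e1 e2 by rewrite lt_min e10.
have h1 := LnormOn_cvg0 p0 e0 wphi.
have h2 : \forall k \near \oo, forall i, (\int[lebesgue_rV n]_(x in Omega)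
    (`|partial i (phi k) x - g x ord0 i| `^ p)%:E <= (Num.min e1 e2)%:E)%E.
  by apply: filter_forall => i; exact: (LnormOn_cvg0 p0 e0 (gphi i)).
have [k [hk1 hk2]] : exists k, (\int[lebesgue_rV n]_(x in Omega)
    (`|phi k x - w x| `^ p)%:E <= (Num.min e1 e2)%:E)%E /\
    forall i, (\int[lebesgue_rV n]_(x in Omega)
    (`|partial i (phi k) x - g x ord0 i| `^ p)%:E <= (Num.min e1 e2)%:E)%E.
  have [N _ hN] := filterI h1 h2.
  by have [] := hN N (leqnn N); exists N.
have [Cphi _ _] := tphi k.
have mphi : measurable_fun Omega (phi k).
  by apply: measurable_funTS; apply: continuous_measurable_rV; exact: (Cphi 0%N).
have mdphi i : measurable_fun Omega (partial i (phi k)).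
  apply: measurable_funTS; apply: continuous_measurable_rV.
  by have [_ /(_ i)] := Cphi 1%N.
have md : measurable_fun Omega (fun x => `|phi k x - w x|).
  by apply: measurableT_comp => //; exact: measurable_funB.
have mdi i : measurable_fun Omega (fun x => `|partial i (phi k) x - g x ord0 i|).
  by apply: measurableT_comp => //; exact: measurable_funB.
have l1 (z : \bar R) : (z <= (Num.min e1 e2)%:E)%E -> (z <= e1%:E)%E.
  by move=> h; apply: (le_trans h); rewrite lee_fin ge_min lexx.
have l2 (z : \bar R) : (z <= (Num.min e1 e2)%:E)%E -> (z <= e2%:E)%E.
  by move=> h; apply: (le_trans h); rewrite lee_fin ge_min lexx orbT.
exists (phi k); split => //.
- by apply: he1 => //; exact: l1.
- by move=> i; apply: he1 => //; apply: l1; exact: hk2.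
- by move=> i; apply: he2 => //; apply: l2; exact: hk2.
Qed.

End Lp_facts.

(** * Energy estimate *)

Section energy.
Context {R : realType} {n : nat}.
Variables (Omega : set 'rV[R]_n) (p k s Lambda F C : R).
Variables (w b : 'rV[R]_n -> R) (g A : 'rV[R]_n -> 'rV[R]_n).
Local Notation mu := (lebesgue_rV n).
Local Notation X := (fun x => enorm (g x)).

Hypotheses (p1 : 1 < p) (mO : measurable Omega) (k0 : 0 < k) (s0 : 0 < s)
  (L0 : 0 <= Lambda) (F0 : 0 <= F) (C0 : 0 <= C)
  (mw : measurable_fun Omega w) (mb : measurable_fun Omega b)
  (mg : forall i, measurable_fun Omega (fun x => g x ord0 i))
  (mA : forall i, measurable_fun Omega (fun x => A x ord0 i))
  (woo : (\int[mu]_(x in Omega) `|w x|%:E < +oo)%E)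
  (Xoo : (\int[mu]_(x in Omega) (enorm (g x) `^ p)%:E < +oo)%E)
  (hA : forall x i, Omega x -> `|A x ord0 i| <= C * enorm (g x) `^ (p - 1))
  (hAg : forall x, Omega x -> enorm (g x) `^ p <= dot (A x) (g x))
  (hbL : forall x, Omega x -> k < `|w x| -> `|b x| <= Lambda)
  (hbF : forall x, Omega x -> `|b x| <= F)
  (weak : forall psi, test_function Omega psi ->
    (\int[mu]_(x in Omega) (dot (A x) (gradient psi x))%:E =
     \int[mu]_(x in Omega) (b x * psi x)%:E)%E).

Variables (phi : 'rV[R]_n -> R) (eta : R).
Hypotheses (tphi : test_function Omega phi)
  (hphi : (\int[mu]_(x in Omega) (`|phi x - w x|)%:E <= eta%:E)%E)
  (hdphi : forall i, (\int[mu]_(x in Omega)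
      (`|partial i phi x - g x ord0 i|)%:E <= eta%:E)%E)
  (hXphi : forall i, (\int[mu]_(x in Omega)
      (enorm (g x) `^ (p - 1) * `|partial i phi x - g x ord0 i|)%:E <= eta%:E)%E).

Local Notation v := (fun x => trunc k s (phi x)).
Local Notation gam := (fun x => dtrunc k s (phi x)).
Local Notation r i := (fun x => `|partial i phi x - g x ord0 i|).

Let dphi x : differentiable phi x.
Proof. by have [/(_ 1%N)[]] := tphi. Qed.

Let mphi : measurable_fun Omega phi.
Proof.
by apply: measurable_funTS; apply: continuous_measurable_rV;
  have [/(_ 0%N)] := tphi.
Qed.

Let mdphi i : measurable_fun Omega (partial i phi).
Proof.
by apply: measurable_funTS; apply: continuous_measurable_rV;
  have [/(_ 1%N)[_ /(_ i)]] := tphi.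
Qed.

Let mv : measurable_fun Omega v.
Proof.
have [/(_ 0%N) Cv _ _] := test_function_trunc k0 s0 tphi.
by apply: measurable_funTS; exact: continuous_measurable_rV.
Qed.

Let mgam : measurable_fun Omega gam.
Proof.
apply: (measurableT_comp (f := dtrunc k s)) => //.
exact: continuous_measurable_fun (@continuous_dtrunc R k s).
Qed.

Let mX : measurable_fun Omega X.
Proof. exact: measurable_enorm. Qed.

Let mXp (q : R) : measurable_fun Omega (fun x => enorm (g x) `^ q).
Proof. exact: measurable_powRn. Qed.

Let mr i : measurable_fun Omega (r i).
Proof. by apply: measurableT_comp => //; exact: measurable_funB. Qed.

Let mpw : measurable_fun Omega (fun x => `|phi x - w x|).
Proof. by apply: measurableT_comp => //; exact: measurable_funB. Qed.

Let mnv : measurable_fun Omega (fun x => `|v x|).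
Proof. by apply: measurableT_comp. Qed.

Let trunc_w x : `|v x| <= `|phi x - w x| + `|w x|.
Proof.
have := trunc_lip k0 s0 (phi x) 0.
rewrite (@trunc_eq0 _ _ _ s0 0) ?normr0 ?(ltW k0)// !subr0 => /le_trans; apply.
by rewrite -{1}(subrK (w x) (phi x)) ler_normD.
Qed.

(** Finiteness is what later allows half of this integral to be absorbed. *)
Lemma trunc_test_lty : (\int[mu]_(x in Omega) `|v x|%:E < +oo)%E.
Proof.
apply: (@le_lt_trans _ _ (\int[mu]_(x in Omega) (`|phi x - w x| + `|w x|)%:E)%E).
  apply: ge0_le_integralE => //.
    by apply: measurable_funD => //; exact: measurableT_comp.
  by move=> x _; rewrite normr_ge0 trunc_w.
rewrite ge0_integralDE//; last exact: measurableT_comp.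
by rewrite lte_add_pinfty// (le_lt_trans hphi)// ltry.
Qed.

Lemma trunc_integral_le :
  (\int[mu]_(x in Omega) `|trunc k s (w x)|%:E <=
   \int[mu]_(x in Omega) `|v x|%:E + eta%:E)%E.
Proof.
apply: (@le_trans _ _ (\int[mu]_(x in Omega) (`|v x| + `|phi x - w x|)%:E)%E).
  apply: ge0_le_integralE => //.
  - apply: measurableT_comp => //; apply: (measurableT_comp (f := trunc k s)) => //.
    apply: continuous_measurable_fun => t.
    by apply/differentiable_continuous/derivable1_diffP; exact: derivable_trunc.
  - exact: measurable_funD.
  - move=> x _; rewrite normr_ge0/= (le_trans _ (lerD (lexx _) (trunc_lip k0 s0 _ _)))//.
    by rewrite -[in leLHS](subKr (v x) (trunc k s (w x))) ler_normB.
by rewrite ge0_integralDE// leeD2l.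
Qed.

(** The weak equation is tested with [v], whose gradient is [gam] times that of [phi]. Replacing the
    latter by [g] on the left costs the term with [C], and the set where |w| <= k costs the term
    with [F] on the right. *)
Lemma energy_le :
  (\int[mu]_(x in Omega) (gam x * enorm (g x) `^ p)%:E <=
   Lambda%:E * \int[mu]_(x in Omega) `|v x|%:E + ((F + C * n%:R) * eta)%:E)%E.
Proof.
pose P x := dot (A x) (gradient v x).
pose Q x := b x * v x.
(* A majorant of |<A, g - grad phi>|. *)
pose S x := C * \sum_i enorm (g x) `^ (p - 1) * r i x.
have PE x : P x = gam x * \sum_i A x ord0 i * partial i phi x.
  rewrite /P /dot mulr_sumr; apply: eq_bigr => i _.
  by rewrite mxE (partial_trunc _ s0)//; ring.
have mXr i : measurable_fun Omega (fun x => enorm (g x) `^ (p - 1) * r i x).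
  exact: measurable_funM.
have mS : measurable_fun Omega S.
  by apply: measurable_funM => //; exact: measurable_sum.
have S0 x : 0 <= S x.
  by rewrite mulr_ge0// sumr_ge0// => i _; rewrite mulr_ge0 ?powR_ge0.
have IS : (\int[mu]_(x in Omega) (S x)%:E <= (C * n%:R * eta)%:E)%E.
  rewrite ge0_integralZlE//; last 2 first.
  - exact: measurable_sum.
  - by move=> x _; apply: sumr_ge0 => i _; rewrite mulr_ge0 ?powR_ge0.
  rewrite ge0_integral_sumE//; last by move=> i x _; rewrite mulr_ge0 ?powR_ge0.
  rewrite -mulrA EFinM; apply: lee_wpmul2l; rewrite ?lee_fin//.
  apply: (@le_trans _ _ (\sum_(i < n) eta%:E)%E); first exact: lee_sum.
  by rewrite sumEFin sumr_const card_ord -(mulr_natl eta).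
have mP : measurable_fun Omega P.
  rewrite (_ : P = fun x => gam x * \sum_i A x ord0 i * partial i phi x); last exact/funext.
  apply: measurable_funM => //; apply: measurable_sum => i; exact: measurable_funM.
have gam01 x : 0 <= gam x <= 1 by rewrite dtrunc_ge0 (dtrunc_le1 k0 s0).
(* [P] and [Q] have no sign, so additivity and monotonicity of their integrals rest on
   integrability. *)
have iS : mu.-integrable Omega (EFin \o S).
  apply: (@integrable_bound _ _ _ _ _ mO _ S) => //.
    by move=> x _; rewrite ger0_norm.
  by rewrite (le_lt_trans IS)// ltry.
have iP : mu.-integrable Omega (EFin \o P).
  apply: (@integrable_bound _ _ _ _ _ mO _ (fun x => S x + C * n%:R * enorm (g x) `^ p)) => //.
  - by apply: measurable_funD => //; apply: measurable_funM.
  - move=> x Ox; rewrite PE normrM.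
    have /andP[g0 g1] := gam01 x; rewrite (ger0_norm g0).
    apply: (@le_trans _ _ (`|\sum_i A x ord0 i * partial i phi x|)).
      by rewrite ler_piMl.
    apply: (le_trans (ler_norm_sum _ _ _)).
    apply: (@le_trans _ _ (\sum_(i < n) (C * (enorm (g x) `^ (p - 1) * r i x) + C * enorm (g x) `^ p))).
      apply: ler_sum => i _; rewrite normrM.
      apply: (@le_trans _ _ (C * enorm (g x) `^ (p - 1) * (r i x + enorm (g x)))).
        rewrite ler_pM ?hA//.
        rewrite -{1}(subrK (g x ord0 i) (partial i phi x)).
        by rewrite (le_trans (ler_normD _ _))// lerD2l coord_le_enorm.
      rewrite mulrDr -!mulrA lerD2l [_ * enorm _]mulrC mulr_powRB1 ?enorm_ge0//.
      by rewrite (lt_trans ltr01).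
    rewrite big_split/= -mulr_sumr lerD2l sumr_const card_ord -(mulr_natr (C * _)).
    by rewrite mulrAC.
  - rewrite ge0_integralDE//; last 2 first.
    + exact: measurable_funM.
    + by move=> x _; rewrite !mulr_ge0 ?powR_ge0.
    rewrite lte_add_pinfty ?(le_lt_trans IS) ?ltry//.
    rewrite ge0_integralZlE//; last 2 first.
    + by rewrite mulr_ge0.
    + by move=> x _; rewrite powR_ge0.
    by rewrite lte_mul_pinfty// lee_fin mulr_ge0.
have mQ : measurable_fun Omega Q by exact: measurable_funM.
have iQ : mu.-integrable Omega (EFin \o Q).
  apply: (@integrable_bound _ _ _ _ _ mO _ (fun x => F * `|v x|)) => //.
  - exact: measurable_funM.
  - by move=> x Ox; rewrite normrM ler_wpM2r// hbF.
  - by rewrite ge0_integralZlE// lte_mul_pinfty// ?lee_fin//; exact: trunc_test_lty.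
have IP : (\int[mu]_(x in Omega) (P x)%:E = \int[mu]_(x in Omega) (Q x)%:E)%E.
  by apply: weak; exact: test_function_trunc.
apply: (@le_trans _ _ (\int[mu]_(x in Omega) (P x + S x)%:E)%E).
  apply: ge0_le_integralE => //.
  - exact: measurable_funM.
  - exact: measurable_funD.
  move=> x Ox; have /andP[g0 g1] := gam01 x; rewrite mulr_ge0 ?powR_ge0//=.
  rewrite PE; apply: (@le_trans _ _ (gam x * dot (A x) (g x))).
    by rewrite ler_wpM2l// hAg.
  rewrite -lerBlDl -mulrBr.
  apply: (@le_trans _ _ (`|dot (A x) (g x) - \sum_i A x ord0 i * partial i phi x|)).
    apply: (le_trans (ler_norm _)); rewrite normrM (ger0_norm g0) ler_piMl//.
  rewrite /dot -sumrB; apply: (le_trans (ler_norm_sum _ _ _)).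
  rewrite /S mulr_sumr; apply: ler_sum => i _.
  by rewrite -mulrBr normrM distrC mulrA ler_wpM2r// hA.
have -> : (\int[mu]_(x in Omega) (P x + S x)%:E =
    \int[mu]_(x in Omega) (P x)%:E + \int[mu]_(x in Omega) (S x)%:E)%E.
  exact: (integralD mO iP iS).
rewrite IP mulrDl EFinD.
apply: (le_trans (leeD2l _ IS)); rewrite [leRHS]addeA; apply: leeD2r.
apply: (@le_trans _ _ (\int[mu]_(x in Omega) (Lambda * `|v x| + F * `|phi x - w x|)%:E)%E).
  apply: (le_integral mO iQ).
    apply: (@integrable_bound _ _ _ _ _ mO _ (fun x => Lambda * `|v x| + F * `|phi x - w x|)).
    - by apply: measurable_funD; apply: measurable_funM.
    - by apply: measurable_funD; apply: measurable_funM.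
    - by move=> x _; rewrite ger0_norm// addr_ge0// mulr_ge0.
    rewrite ge0_integralDE//.
    - rewrite !ge0_integralZlE// lte_add_pinfty// lte_mul_pinfty// ?lee_fin//.
        exact: trunc_test_lty.
      by rewrite (le_lt_trans hphi)// ltry.
    - exact: measurable_funM.
    - exact: measurable_funM.
    - by move=> x _; rewrite mulr_ge0.
    - by move=> x _; rewrite mulr_ge0.
  move=> x; rewrite inE => Ox; rewrite lee_fin /Q.
  apply: (le_trans (ler_norm _)); rewrite normrM.
  (* Where |w| <= k the truncation of [w] vanishes, so the contraction property gives |v| <= |phi -
     w|. *)
  have [kw|wk] := ltP k `|w x|.
    apply: (@le_trans _ _ (Lambda * `|v x|)); first by rewrite ler_wpM2r// hbL.
    by rewrite lerDl mulr_ge0.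
  apply: (@le_trans _ _ (F * `|phi x - w x|)); last by rewrite lerDr mulr_ge0.
  apply: ler_pM => //; first exact: hbF.
  have := trunc_lip k0 s0 (phi x) (w x).
  by rewrite (trunc_eq0 s0 wk) subr0.
rewrite ge0_integralDE//; last 4 first.
- exact: measurable_funM.
- exact: measurable_funM.
- by move=> x _; rewrite mulr_ge0.
- by move=> x _; rewrite mulr_ge0.
rewrite !ge0_integralZlE//; apply: leeD2l.
by rewrite EFinM; apply: lee_wpmul2l; rewrite ?lee_fin.
Qed.

(** Pointwise |d_i v| <= gam (|d_i phi - g_i| + |g|), and Young's inequality is applied to |g|
    alone. The factor [gam] is kept in front of |g|^p, as in the energy, and bounded by 1 elsewhere;
    it vanishes where |phi| <= k. *)
Lemma gradient_trunc_le (B delta : R) (i : 'I_n) : 0 < delta ->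
  (mu [set x | Omega x /\ (k < `|phi x|)%R] <= B%:E)%E ->
  (\int[mu]_x `|partial i v x|%:E <= (delta * B + eta)%:E +
    (delta `^ (1 - p))%:E * \int[mu]_(x in Omega) (gam x * enorm (g x) `^ p)%:E)%E.
Proof.
move=> d0 SB; pose S := [set x | Omega x /\ k < `|phi x|].
have mS : measurable S.
  have -> : S = Omega `&` (fun x => `|phi x|) @^-1` `]k, +oo[%classic.
    by apply/seteqP; split=> x /=; rewrite in_itv/= andbT.
  have mp : measurable_fun Omega (fun x => `|phi x|) by exact: measurableT_comp.
  exact: mp.
have mI : measurable_fun Omega (\1_S : _ -> R) by exact: measurable_indic.
(* The Poincare inequality integrates over the whole space, the energy over [Omega]; the two domains
   agree because [phi] vanishes outside [Omega]. *)
have off x : ~ Omega x -> partial i v x = 0.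
  move=> Ox; rewrite (partial_trunc _ s0)//.
  have -> : phi x = 0.
    apply: contrapT => /eqP px; apply: Ox.
    by have [_ _] := tphi; apply; exact: subset_closure.
  by rewrite (dtrunc_eq0 s0) ?mul0r// normr0 ltW.
have -> : (\int[mu]_x `|partial i v x|%:E = \int[mu]_(x in Omega) `|partial i v x|%:E)%E.
  rewrite [RHS]integral_mkcond; apply: eq_integral => x _.
  by rewrite patchE; case: ifPn => //; rewrite notin_setE => /off ->; rewrite normr0.
have mgX : measurable_fun Omega (fun x => gam x * enorm (g x) `^ p).
  exact: measurable_funM.
apply: (@le_trans _ _ (\int[mu]_(x in Omega)
    ((delta * \1_S x + r i x) + delta `^ (1 - p) * (gam x * enorm (g x) `^ p))%:E)%E).
  apply: ge0_le_integralE => //.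
  - apply: measurableT_comp => //.
    rewrite (_ : partial i v = fun x => gam x * partial i phi x).
      exact: measurable_funM.
    by apply/funext => x; rewrite (partial_trunc _ s0).
  - by apply: measurable_funD; [apply: measurable_funD => //|]; exact: measurable_funM.
  move=> x Ox; rewrite normr_ge0/= (partial_trunc _ s0)// normrM.
  have g0 := dtrunc_ge0 k s (phi x); have g1 := dtrunc_le1 k0 s0 (phi x).
  rewrite (ger0_norm g0).
  have h1 : `|partial i phi x| <= r i x + enorm (g x).
    rewrite -{1}(subrK (g x ord0 i) (partial i phi x)).
    by rewrite (le_trans (ler_normD _ _))// lerD2l coord_le_enorm.
  apply: (@le_trans _ _ (dtrunc k s (phi x) * (r i x + enorm (g x)))).
    by rewrite ler_wpM2l.
  rewrite mulrDr addrAC [leRHS]addrC lerD//; first by rewrite ler_piMl.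
  rewrite indicE; have [Sx|] := boolP (x \in S).
    rewrite mulr1; have y := young1 p1 (enorm_ge0 (g x)) d0.
    apply: (@le_trans _ _ (dtrunc k s (phi x) *
      (delta + delta `^ (1 - p) * enorm (g x) `^ p))); first by rewrite ler_wpM2l.
    by rewrite mulrDr mulrCA lerD2r ler_piMl// ltW.
  rewrite notin_setE/= => nS.
  have pk : `|phi x| <= k by rewrite leNgt; apply/negP => h; exact: nS.
  by rewrite (dtrunc_eq0 s0 pk) !mul0r !mulr0 addr0.
rewrite ge0_integralDE//; last 4 first.
- by apply: measurable_funD => //; exact: measurable_funM.
- exact: measurable_funM.
- by move=> x _; rewrite addr_ge0// mulr_ge0// ltW.
- by move=> x _; rewrite !mulr_ge0 ?powR_ge0 ?dtrunc_ge0.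
rewrite ge0_integralZlE ?powR_ge0//; last first.
  by move=> x _; rewrite !mulr_ge0 ?powR_ge0 ?dtrunc_ge0.
apply: leeD2r; rewrite EFinD ge0_integralDE//; last 2 first.
- exact: measurable_funM.
- by move=> x _; rewrite mulr_ge0// ltW.
apply: leeD => //; rewrite ge0_integralZlE ?(ltW d0)// EFinM.
apply: lee_wpmul2l; first by rewrite lee_fin ltW.
rewrite integral_indic//; apply: le_trans SB.
by apply: le_measure; rewrite ?inE//; exact: measurableI.
Qed.

End energy.

(** * Decay of the level sets *)

(** With L^n = 4 alpha, the product L * L^(1/(p-1)) = L^(p/(p-1)) equals (4 alpha)^theta. *)
Definition theta {R : realType} (n : nat) (p : R) : R := p / (n%:R * (p - 1)).

(** The factor 16 e n is 8 n, from 4 L n delta (2 alpha), divided by 1/(2e), from the lower bound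
    (h-k1)/(2e) for the truncation on the level set of h. The powers are what L and delta
    contribute. *)
Definition decay_cst {R : realType} (n : nat) (p : R) : R :=
  16 * expR 1 * n%:R * (4 * n%:R) `^ (p - 1)^-1 * 4 `^ (theta n p).

Section level_sets.
Context {R : realType} {n : nat}.
Variables (Omega : set 'rV[R]_n) (p Lambda F C : R).
Variables (w b : 'rV[R]_n -> R) (g A : 'rV[R]_n -> 'rV[R]_n).
Local Notation mu := (lebesgue_rV n).

Hypotheses (n0 : (0 < n)%N) (p1 : 1 < p) (mO : measurable Omega)
  (L0 : 0 < Lambda) (F0 : 0 <= F) (C0 : 0 <= C)
  (mw : measurable_fun Omega w) (mb : measurable_fun Omega b)
  (mg : forall i, measurable_fun Omega (fun x => g x ord0 i))
  (mA : forall i, measurable_fun Omega (fun x => A x ord0 i))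
  (woo : (\int[mu]_(x in Omega) `|w x|%:E < +oo)%E)
  (Xoo : (\int[mu]_(x in Omega) (enorm (g x) `^ p)%:E < +oo)%E)
  (hA : forall x i, Omega x -> `|A x ord0 i| <= C * enorm (g x) `^ (p - 1))
  (hAg : forall x, Omega x -> enorm (g x) `^ p <= dot (A x) (g x))
  (hbF : forall x, Omega x -> `|b x| <= F)
  (weak : forall psi, test_function Omega psi ->
    (\int[mu]_(x in Omega) (dot (A x) (gradient psi x))%:E =
     \int[mu]_(x in Omega) (b x * psi x)%:E)%E)
  (approx : forall eta : R, 0 < eta -> exists phi, [/\ test_function Omega phi,
    (\int[mu]_(x in Omega) (`|phi x - w x|)%:E <= eta%:E)%E,
    forall i, (\int[mu]_(x in Omega)
      (`|partial i phi x - g x ord0 i|)%:E <= eta%:E)%E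
  & forall i, (\int[mu]_(x in Omega)
      (enorm (g x) `^ (p - 1) * `|partial i phi x - g x ord0 i|)%:E <= eta%:E)%E]).

Definition level (t : R) : set 'rV[R]_n := [set x | Omega x /\ t < `|w x|].

Lemma measurable_level t : measurable (level t).
Proof.
have -> : level t = Omega `&` (fun x => `|w x|) @^-1` `]t, +oo[%classic.
  by apply/seteqP; split=> x /=; rewrite in_itv/= andbT.
have mp : measurable_fun Omega (fun x => `|w x|) by exact: measurableT_comp.
exact: mp.
Qed.

(** The Poincare, gradient and energy bounds form a closed system for V = \int |v|, in which V
    reappears with the coefficient 2 L n Lambda delta^(1-p) = 1/2. *)
Lemma trunc_level_le (k1 k s alpha L delta : R) :
  0 < k1 -> k1 < k -> 0 < s -> 0 < alpha -> 0 < L ->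
  L ^+ n = 2 * (2 * alpha) -> 0 < delta ->
  4 * L * n%:R * Lambda * delta `^ (1 - p) = 1 ->
  (forall x, Omega x -> k1 < `|w x| -> `|b x| <= Lambda) ->
  (mu (level k1) <= alpha%:E)%E ->
  (\int[mu]_(x in Omega) `|trunc k s (w x)|%:E <=
    (4 * L * n%:R * delta * (2 * alpha))%:E)%E.
Proof.
move=> k10 k1k s0 al0 Lp LB d0 dE hbL1 Al.
have k0 : 0 < k by exact: lt_trans k1k.
have hbL x : Omega x -> k < `|w x| -> `|b x| <= Lambda.
  by move=> Ox kx; apply: hbL1 => //; exact: lt_trans kx.
pose c := delta `^ (1 - p).
have c0 : 0 < c by rewrite powR_gt0.
pose K1 := F + C * n%:R.
have K10 : 0 <= K1 by rewrite addr_ge0// mulr_ge0.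
(* All coefficients of [eta] in the final estimate; the last 1 comes from passing from the
   truncation of [phi] back to that of [w]. *)
pose K2 := 4 * L * n%:R * (1 + c * K1) + 1.
have K20 : 0 < K2.
  by rewrite ltr_wpDl// !mulr_ge0 ?addr_ge0 ?mulr_ge0// ltW.
apply/lee_addgt0Pr => e e0.
(* The first bound makes the set where |phi - w| >= k - k1 have measure at most [alpha]; the second
   makes the total error at most [e]. *)
pose eta := Num.min ((k - k1) * alpha) (e / K2).
have eta0 : 0 < eta by rewrite lt_min mulr_gt0 ?divr_gt0 ?subr_gt0.
have eta1 : eta <= (k - k1) * alpha by rewrite ge_min lexx.
have eta2 : K2 * eta <= e by rewrite mulrC -ler_pdivlMr// ge_min lexx orbT.
have [phi [tphi hphi hdphi hXphi]] := approx eta0.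
have [Cphi _ sphi] := tphi.
have mphi : measurable_fun Omega phi.
  by apply: measurable_funTS; apply: continuous_measurable_rV; exact: (Cphi 0%N).
(* If |phi| > k, then |w| > k1 or |phi - w| >= k - k1; each alternative contributes [alpha]. *)
have SB : (mu [set x | Omega x /\ (k < `|phi x|)%R] <= (2 * alpha)%:E)%E.
  pose W := [set x | Omega x /\ (k - k1 <= `|phi x - w x|)%R].
  have mW : measurable W.
    have -> : W = Omega `&` (fun x => `|phi x - w x|) @^-1` `[k - k1, +oo[%classic.
      by apply/seteqP; split=> x /=; rewrite in_itv/= andbT.
    have mp : measurable_fun Omega (fun x => `|phi x - w x|).
      by apply: measurableT_comp => //; exact: measurable_funB.
    exact: mp.
  have mS : measurable [set x | Omega x /\ (k < `|phi x|)%R].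
    have -> : [set x | Omega x /\ (k < `|phi x|)%R] =
        Omega `&` (fun x => `|phi x|) @^-1` `]k, +oo[%classic.
      by apply/seteqP; split=> x /=; rewrite in_itv/= andbT.
    have mp : measurable_fun Omega (fun x => `|phi x|) by exact: measurableT_comp.
    exact: mp.
  have WB : (mu W <= alpha%:E)%E.
    have kk : 0 < k - k1 by rewrite subr_gt0.
    have : ((k - k1)%:E * mu W <= (k - k1)%:E * alpha%:E)%E.
      rewrite -EFinM; apply: (@le_trans _ _ (eta%:E)); last by rewrite lee_fin.
      apply: le_trans hphi; apply: ge0_integral_setE => //.
      - by move=> x [].
      - exact: ltW.
      - by apply: measurableT_comp => //; exact: measurable_funB.
      - by move=> x [].
    by rewrite lee_pmul2l// lte_fin.
  apply: (@le_trans _ _ (mu (level k1 `|` W))).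
    apply: le_measure; rewrite ?inE//.
      by apply: measurableU => //; exact: measurable_level.
    move=> x [Ox kx]; have [k1w|wk1] := ltP k1 `|w x|; [by left|right].
    split=> //; rewrite lerBlDr (le_trans (ltW kx))//.
    rewrite -{1}(subrK (w x) (phi x)) (le_trans (ler_normD _ _))//.
    by rewrite lerD2l.
  apply: (le_trans (measureU2 _ (measurable_level _) mW)).
  have -> : (2 * alpha = alpha + alpha) by ring.
  by rewrite EFinD leeD.
pose v x := trunc k s (phi x).
pose V := (\int[mu]_(x in Omega) `|v x|%:E)%E.
pose E := (\int[mu]_(x in Omega) (dtrunc k s (phi x) * enorm (g x) `^ p)%:E)%E.
have EV : (E <= Lambda%:E * V + (K1 * eta)%:E)%E.
  exact: (energy_le p1 mO k0 s0 (ltW L0) F0 C0 mw mb mg mA woo Xoo hA hAg hbL hbF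
    weak tphi hphi hXphi).
have Voo : (V < +oo)%E by exact: (trunc_test_lty mO k0 s0 mw woo tphi hphi).
have V0 : (0 <= V)%E by apply: integral_ge0 => x _; rewrite lee_fin.
have E0 : (0 <= E)%E.
  by apply: integral_ge0 => x _; rewrite lee_fin mulr_ge0 ?powR_ge0 ?dtrunc_ge0.
have Vf : V \is a fin_num by rewrite ge0_fin_numE.
have Ef : E \is a fin_num.
  rewrite ge0_fin_numE// (le_lt_trans EV)// lte_add_pinfty ?ltry//.
  by rewrite lte_mul_pinfty// lee_fin ltW.
have [Cv _ sv] := test_function_trunc k0 s0 tphi.
have v0 x : ~ Omega x -> v x = 0.
  move=> Ox; apply: contrapT => /eqP vx; apply: Ox.
  by apply: sv; exact: subset_closure.
have VE : (\int[mu]_x `|v x|%:E = V)%E.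
  rewrite [RHS]integral_mkcond; apply: eq_integral => x _.
  by rewrite patchE; case: ifPn => //; rewrite notin_setE => /v0 ->; rewrite normr0.
have VP : (V <= (2 * L)%:E * \sum_i \int[mu]_x `|partial i v x|%:E)%E.
  rewrite -VE; apply: (@poincare_support _ _ v (2 * alpha) L).
  - by have [] := Cv 1%N.
  - by move=> i; have [_ /(_ i)] := Cv 1%N.
  - by rewrite mulr_gt0.
  - exact: ltW.
  - exact: LB.
  - apply: le_trans SB; apply: le_measure; rewrite ?inE.
    + apply: open_measurable_rV; rewrite (_ : [set x | _] = v @^-1` [set y | y != 0])//.
      by apply: open_comp => [x _|]; [exact: (Cv 0%N)|exact: open_neq].
    + have -> : [set x | Omega x /\ (k < `|phi x|)%R] =
        Omega `&` (fun x => `|phi x|) @^-1` `]k, +oo[%classic.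
        by apply/seteqP; split=> x /=; rewrite in_itv/= andbT.
      have mp : measurable_fun Omega (fun x => `|phi x|) by exact: measurableT_comp.
      exact: mp.
    + move=> x /= vx; split.
        by apply: contrapT => /v0 vx0; rewrite vx0 eqxx in vx.
      rewrite ltNge; apply: contra vx => pk.
      by rewrite /v (trunc_eq0 s0 pk).
  - by rewrite VE.
have dV i : (\int[mu]_x `|partial i v x|%:E <= (delta * (2 * alpha) + eta)%:E + c%:E * E)%E.
  exact: (gradient_trunc_le p1 mO k0 s0 mg tphi hdphi i d0 SB).
have VR : fine V <= 2 * L * (n%:R * (delta * (2 * alpha) + eta + c * fine E)).
  rewrite -lee_fin fineK//; apply: (le_trans VP); rewrite [leRHS]EFinM.
  apply: lee_wpmul2l; first by rewrite lee_fin mulr_ge0// ltW.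
  apply: (@le_trans _ _ (\sum_(i < n) (delta * (2 * alpha) + eta + c * fine E)%:E)%E).
    by apply: lee_sum => i _; rewrite EFinD EFinM fineK.
  by rewrite sumEFin sumr_const card_ord -(mulr_natl (_ + c * fine E)).
have ER : fine E <= Lambda * fine V + K1 * eta.
  by rewrite -lee_fin fineK// EFinD EFinM fineK.
have n1 : 0 < n%:R :> R by rewrite ltr0n.
apply: (@le_trans _ _ (V + eta%:E)%E).
  exact: (trunc_integral_le mO k0 s0 mw tphi hphi).
rewrite -(fineK Vf) -!EFinD lee_fin.
set D := delta * (2 * alpha) in VR *.
have -> : 4 * L * n%:R * delta * (2 * alpha) = 4 * L * n%:R * D by rewrite /D; ring.
apply: (@le_trans _ _ (4 * L * n%:R * D + K2 * eta)); last by rewrite lerD2l.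
rewrite /K2.
have h : 2 * L * n%:R * c * fine E <= 2 * L * n%:R * c * (Lambda * fine V + K1 * eta).
  by rewrite ler_wpM2l// !mulr_ge0// ltW.
(* The choice of [delta] gives [V] the coefficient 1/2 here, to be absorbed on the left. *)
have h2 : 2 * L * n%:R * c * (Lambda * fine V + K1 * eta) =
    fine V / 2 + 2 * L * n%:R * c * K1 * eta.
  rewrite (_ : fine V / 2 = (4 * L * n%:R * Lambda * delta `^ (1 - p)) * fine V / 2).
    by rewrite -/c; field.
  by rewrite dE mul1r.
lra.
Qed.

Lemma level_decay (k1 h alpha : R) : 0 < k1 -> k1 < h -> 0 <= alpha ->
  (forall x, Omega x -> k1 < `|w x| -> `|b x| <= Lambda) ->
  (mu (level k1) <= alpha%:E)%E ->
  (mu (level h) <= (decay_cst n p * Lambda `^ (p - 1)^-1 / (h - k1)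
      * alpha `^ (1 + theta n p))%:E)%E.
Proof.
(* For [alpha = 0] the side [L] and the parameter [delta] would vanish; monotonicity of the level
   sets suffices. *)
move=> k10 k1h; rewrite le_eqVlt => /predU1P[<-|al0] hbL Al.
  have th : 1 + theta n p != 0.
    by rewrite gt_eqF// ltr_pwDl// divr_ge0 ?mulr_ge0 ?subr_ge0 ?(ltW p1)// (le_trans ler01)// ltW.
  rewrite powR0// mulr0; apply: le_trans Al.
  apply: le_measure; rewrite ?inE; [exact: measurable_level..|].
  by move=> x [Ox hx]; split=> //; exact: lt_trans hx.
have n1 : 0 < n%:R :> R by rewrite ltr0n.
have p10 : 0 < p - 1 by rewrite subr_gt0.
(* Half of the gap pays for the passage from [w] to [phi], the other half lets the truncation rise
   to [s / e]. *)
pose s := (h - k1) / 2; have s0 : 0 < s by rewrite divr_gt0// subr_gt0.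
pose k := k1 + s.
have k1k : k1 < k by rewrite ltrDl.
have k0 : 0 < k by exact: lt_trans k1k.
have hE : h = k + s by rewrite /k /s; field.
pose L := (4 * alpha) `^ n%:R^-1.
have Lp : 0 < L by rewrite powR_gt0// mulr_gt0.
have LB : L ^+ n = 2 * (2 * alpha).
  rewrite -powR_mulrn ?powR_ge0// -powRrM mulVf ?gt_eqF// powRr1; first by ring.
  by rewrite mulr_ge0// ltW.
pose Y := 4 * L * n%:R * Lambda.
have Y0 : 0 < Y by rewrite !mulr_gt0.
pose delta := Y `^ (p - 1)^-1.
have d0 : 0 < delta by rewrite powR_gt0.
have dE : 4 * L * n%:R * Lambda * delta `^ (1 - p) = 1.
  rewrite -/Y /delta -powRrM (_ : (p - 1)^-1 * (1 - p) = -1).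
    by rewrite powR_inv1 ?(ltW Y0)// divff// gt_eqF.
  by rewrite -[1 - p]opprB mulrN mulVf ?gt_eqF.
have T := trunc_level_le k10 k1k s0 al0 Lp LB d0 dE hbL Al.
have se : 0 < s * expR (-1) by rewrite mulr_gt0// expR_gt0.
have : ((s * expR (-1))%:E * mu (level h) <= (4 * L * n%:R * delta * (2 * alpha))%:E)%E.
  apply: le_trans T; apply: ge0_integral_setE => //.
  - exact: measurable_level.
  - by move=> x [].
  - exact: ltW.
  - apply: measurableT_comp => //; apply: (measurableT_comp (f := trunc k s)) => //.
    apply: continuous_measurable_fun => t.
    by apply/differentiable_continuous/derivable1_diffP; exact: derivable_trunc.
  - by move=> x [Ox hx]; apply: (trunc_ge k0 s0); rewrite -hE ltW.
have -> : 4 * L * n%:R * delta * (2 * alpha) = s * expR (-1) *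
    (decay_cst n p * Lambda `^ (p - 1)^-1 / (h - k1) * alpha `^ (1 + theta n p)).
  rewrite powRD ?(gt_eqF al0) ?implybT// powRr1 ?(ltW al0)//.
  have -> : delta = (4 * n%:R) `^ (p - 1)^-1 * L `^ (p - 1)^-1 * Lambda `^ (p - 1)^-1.
    rewrite /delta (_ : Y = (4 * n%:R) * L * Lambda); last by rewrite /Y; ring.
    by rewrite !powRM ?mulr_ge0 ?(ltW Lp) ?(ltW L0).
  have LL : L * L `^ (p - 1)^-1 = 4 `^ theta n p * alpha `^ theta n p.
    rewrite -{1}(powRr1 (ltW Lp)) -powRD ?(gt_eqF Lp) ?implybT// /L -powRrM.
    rewrite -powRM// ?(ltW al0)//; congr powR; rewrite /theta; field.
    by rewrite !gt_eqF.
  transitivity (8 * n%:R * alpha * (4 * n%:R) `^ (p - 1)^-1 *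
    Lambda `^ (p - 1)^-1 * (L * L `^ (p - 1)^-1)); first by ring.
  rewrite LL /decay_cst /s expRN.
  have hk : h - k1 != 0 by rewrite subr_eq0 gt_eqF.
  have e1 : expR 1 != 0 :> R by rewrite gt_eqF ?expR_gt0.
  by field; rewrite e1 hk.
by rewrite [X in (_ <= X)%E -> _]EFinM lee_pmul2l// lte_fin.
Qed.

End level_sets.

(** [G] is continuous only relative to closure Omega x R^n, so the preimage of an interval is the
    trace of an open set [V]. Measurability is read off from the preimage of [V] under a map defined
    on the whole space. *)
Lemma measurable_field {R : realType} n (Omega : set 'rV[R]_n)
    (G : 'rV[R]_n * 'rV[R]_n -> 'rV[R]_n) (g : 'rV[R]_n -> 'rV[R]_n) i :
  open Omega -> {within closure Omega `*` setT, continuous G} ->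
  (forall j, measurable_fun Omega (fun x => g x ord0 j)) ->
  measurable_fun Omega (fun x => G (x, g x) ord0 i).
Proof.
move=> oO cG mg; have mO := open_measurable_rV oO.
(* Extending [g] by 0 outside [Omega] makes this map measurable everywhere. *)
pose h (x : 'rV[R]_n) : 'rV[R]_n * 'rV[R]_n := (x, \row_j (\1_Omega x * g x ord0 j)).
have hE x : Omega x -> h x = (x, g x).
  move=> Ox; congr pair; apply/rowP => j.
  by rewrite mxE indicE mem_set// mul1r.
have mh : measurable_fun setT h.
  apply/measurable_fun_pairP; split; first exact: measurable_id.
  apply: measurable_fun_rV => j.
  rewrite (_ : _ \o _ = (fun x => g x ord0 j) \_ Omega).
    have := (measurable_restrictT (fun x => g x ord0 j) mO).1 (mg j). exact.
  apply/funext => x; rewrite /coord_rV/= mxE patchE indicE.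
  by case: ifPn; rewrite ?mul1r ?mul0r.
apply: (measurability _ (RGenOpens.measurableE R)).
move=> _ [_ [a [b ->] <-]].
set U := `]a, b[%classic.
have oU : open ((fun z => G z ord0 i) @^-1` U : set (subspace (closure Omega `*` setT))).
  have cGi : {within closure Omega `*` setT, continuous (fun z => G z ord0 i)}.
    move=> z; apply: (@continuous_comp _ _ _ (G : subspace _ -> _) (fun M : 'rV[R]_n => M ord0 i)).
      exact: cG.
    exact: coord_continuous.
  by move/continuousP : cGi; apply; exact: interval_open.
have [V oV VE] := (open_subspaceP _ _).1 oU.
rewrite (_ : _ `&` _ = Omega `&` h @^-1` V).
  apply: measurableI => //; rewrite -[X in measurable X]setTI.
  by apply: mh => //; exact: open_measurable_rVX.
have inV x : Omega x -> V (h x) <-> U (G (x, g x) ord0 i).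
  move=> Ox; have D : (closure Omega `*` setT) (x, g x).
    by split => //; exact: subset_closure.
  have := f_equal (fun S : set _ => S (x, g x)) VE; rewrite hE// /setI/= => E.
  split=> Q.
    by have : V (x, g x) /\ (closure Omega `*` setT) (x, g x) by []; rewrite E => -[].
  by have : U (G (x, g x) ord0 i) /\ (closure Omega `*` setT) (x, g x) by []; rewrite -E => -[].
by apply/seteqP; split => x [Ox Q]; split => //; apply/(inV x Ox).
Qed.

(** * Iteration of the decay estimate *)

Section stampacchia.
Context {R : realType}.

(** The levels k0 + d (1 - 2^-j) stay below k0 + d, and the superlinear power makes [A] decay
    geometrically along them although the gaps shrink geometrically. *)
Lemma stampacchia (A : R -> R) (k0 K th : R) :
  0 < th -> 0 < K -> (forall t, 0 <= A t) -> {homo A : s t / s <= t >-> t <= s} ->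
  (forall k h, k0 <= k -> k < h -> A h <= K / (h - k) * A k `^ (1 + th)) ->
  A (k0 + K * A k0 `^ th * 2 `^ (1 + th^-1)) = 0.
Proof.
move=> th0 K0 A0 Am HA.
have [Ak0|Ak0] := eqVneq (A k0) 0.
  by rewrite Ak0 powR0 ?gt_eqF// mulr0 mul0r addr0.
have Ap : 0 < A k0 by rewrite lt_neqAle eq_sym Ak0 A0.
set d := K * A k0 `^ th * 2 `^ (1 + th^-1).
have d0 : 0 < d by rewrite !mulr_gt0 ?powR_gt0.
(* The ratio for which r^th = 1/2, so that the gain (r^j)^th compensates the halving of the gaps. *)
pose r : R := 2 `^ (- th^-1).
have r0 : 0 < r by rewrite powR_gt0.
have rth : r `^ th = 2^-1.
  by rewrite /r -powRrM mulNr mulVf ?gt_eqF// powR_inv1.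
have r1 : r < 1.
  rewrite ltNge; apply/negP => r1.
  have : r `^ th < 1 by rewrite rth; lra.
  have : 1 `^ th <= r `^ th by rewrite ge0_ler_powR ?nnegrE ?(ltW r0) ?(ltW th0).
  by rewrite powR1 leNgt => /negbTE ->.
pose kk j : R := k0 + d * (1 - 2^-1 ^+ j).
have kk0 j : k0 <= kk j.
  rewrite lerDl mulr_ge0 ?(ltW d0)// subr_ge0 exprn_ile1//; lra.
have kkd j : kk j <= k0 + d.
  by rewrite lerD2l ler_piMr ?(ltW d0)// gerBl exprn_ge0.
have claim j : A (kk j) <= A k0 * r ^+ j.
  elim: j => [|j IH]; first by rewrite /kk !expr0 subrr mulr0 addr0 mulr1.
  have hk : kk j.+1 - kk j = d * 2^-1 ^+ j.+1 by rewrite /kk !exprS; field.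
  have p2 : 0 < 2^-1 ^+ j :> R by rewrite exprn_gt0.
  have hlt : kk j < kk j.+1.
    by rewrite -subr_gt0 hk mulr_gt0// exprn_gt0.
  apply: (le_trans (HA _ _ (kk0 j) hlt)); rewrite hk.
  apply: (@le_trans _ _ (K / (d * 2^-1 ^+ j.+1) * (A k0 * r ^+ j) `^ (1 + th))).
    rewrite ler_wpM2l//; first by rewrite divr_ge0 ?(ltW K0)// mulr_ge0 ?(ltW d0) ?exprn_ge0.
    apply: ge0_ler_powR; rewrite ?nnegrE//.
      by rewrite addr_ge0// ltW.
    by rewrite mulr_ge0 ?exprn_ge0// ltW.
  (* Equality holds: [d] equals 2 K A(k0)^th / r, exactly what the induction step requires. *)
  rewrite le_eqVlt; apply/orP; left; apply/eqP.
  have rj : 0 < r ^+ j by rewrite exprn_gt0.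
  have Arj : 0 < A k0 * r ^+ j by rewrite mulr_gt0.
  have -> : (A k0 * r ^+ j) `^ (1 + th) = A k0 * r ^+ j * (A k0 * r ^+ j) `^ th.
    by rewrite powRD ?(gt_eqF Arj) ?implybT// powRr1// ltW.
  rewrite powRM ?(ltW Ap) ?(ltW rj)//.
  have -> : (r ^+ j) `^ th = 2^-1 ^+ j.
    rewrite -powR_mulrn ?(ltW r0)// -powRrM mulrC powRrM rth powR_mulrn//.
  have -> : d = K * A k0 `^ th * 2 / r.
    have two : ((1 + th^-1 == 0) ==> ((2:R) != 0)) by rewrite pnatr_eq0 implybT.
    by rewrite /d (powRD two) powRr1// /r powRN invrK; ring.
  have At : A k0 `^ th != 0 by rewrite gt_eqF// powR_gt0.
  rewrite !exprS; field.
  by rewrite At !gt_eqF.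
have z : A (k0 + d) <= 0.
  have lim : A k0 * r ^+ j @[j --> \oo] --> (0:R).
    rewrite [X in _ --> X](_ : _ = A k0 * 0); last by rewrite mulr0.
    apply: cvgMl_tmp; apply: cvg_expr.
    by rewrite ger0_norm ?(ltW r0).
  apply: (cvgr_to_ge lim); near=> j.
  exact: le_trans (Am _ _ (kkd j)) (claim j).
by apply/eqP; rewrite eq_le z A0.
Unshelve. all: by end_near. Qed.

End stampacchia.

(** * The constants and the two alternatives *)

Section constants.
Context {R : realType}.

(** The power 1/theta solves the bound on M for the measure of the level set; 2^r comes from
    Chebyshev's inequality at the level M/2. *)
Definition cst0 (n : nat) (p r : R) : R :=
  (2 * decay_cst n p * 2 `^ (1 + (theta n p)^-1)) `^ (theta n p)^-1 * 2 `^ r.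

(** The larger summand of [Lambda] counted twice gives 4(c+1) here and 2(d+1) in [cst2], raised to
    n/p = 1/(theta (p-1)). The outer exponent is the inverse of the power of M left on the left-hand
    side. *)
Definition cst1 (n : nat) (p q r rho c : R) : R :=
  (cst0 n p r * (4 * (c + 1)) `^ (n%:R / p)) `^ (p / (n%:R * (p - q) + r * p)).

Definition cst2 (n : nat) (p r rho d : R) : R :=
  (cst0 n p r * (2 * (d + 1)) `^ (n%:R / p)) `^ (p / (n%:R * (p - 1) + r * p)).

Lemma decay_cst_gt0 (n : nat) (p : R) : (0 < n)%N -> 0 < decay_cst n p.
Proof.
by move=> n0; rewrite /decay_cst !mulr_gt0 ?powR_gt0 ?mulr_gt0 ?expR_gt0 ?ltr0n.
Qed.

Lemma cst0_gt0 (n : nat) (p r : R) : (0 < n)%N -> 0 < cst0 n p r.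
Proof.
move=> n0; have D := decay_cst_gt0 p n0.
apply: mulr_gt0; last exact: powR_gt0.
by apply: powR_gt0; rewrite mulr_gt0 ?powR_gt0// mulr_gt0.
Qed.

Lemma powR_root (M N B e r : R) : 0 < M -> 0 <= N -> 0 <= B -> 0 < e ->
  M `^ e <= B * N `^ r -> M <= B `^ e^-1 * N `^ (r / e).
Proof.
move=> M0 N0 B0 e0 h.
have -> : M = (M `^ e) `^ e^-1.
  by rewrite -powRrM divff ?gt_eqF// powRr1// ltW.
rewrite powRrM -powRM ?powR_ge0//.
by apply: ge0_ler_powR h; rewrite ?nnegrE ?mulr_ge0 ?powR_ge0// invr_ge0 ltW.
Qed.

(** Raising the bound on [M] to the power 1/theta makes [A0] appear linearly, so multiplication by
    M^r lets Chebyshev's inequality replace [A0] by N^r. *)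
Lemma constants_bound (n : nat) (p q r rho c d M N A0 : R) :
  (0 < n)%N -> 1 < p -> 0 < q <= p -> 0 < r -> 0 <= c -> 0 <= d ->
  0 < M -> 0 <= N -> 0 <= A0 -> (M / 2) `^ r * A0 <= N `^ r ->
  M <= 2 * (decay_cst n p *
     (2 * (c + 1) * M `^ (q - 1) + (d + 1)) `^ (p - 1)^-1 *
     A0 `^ theta n p * 2 `^ (1 + (theta n p)^-1)) ->
  M <= Num.max (cst1 n p q r rho c * N `^ (r * p / (n%:R * (p - q) + r * p)))
     (cst2 n p r rho d * N `^ (r * p / (n%:R * (p - 1) + r * p))).
Proof.
move=> n0 p1 /andP[q0 qp] r0 c0 d0 M0 N0 A00 hA.
have nR : 0 < n%:R :> R by rewrite ltr0n.
have p0 : 0 < p by rewrite (lt_trans ltr01).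
have p10 : 0 < p - 1 by rewrite subr_gt0.
set th := theta n p; have th0 : 0 < th by rewrite divr_gt0// mulr_gt0.
have D0 := decay_cst_gt0 p n0.
set La := 2 * (c + 1) * M `^ (q - 1) + (d + 1).
have c10 : 0 < c + 1 by rewrite ltr_wpDl.
have d10 : 0 < d + 1 by rewrite ltr_wpDl.
have La0 : 0 < La by rewrite addr_gt0// !mulr_gt0// powR_gt0.
move=> h.
have {}h : M `^ th^-1 <= (2 * decay_cst n p * 2 `^ (1 + th^-1)) `^ th^-1 *
    La `^ (n%:R / p) * A0.
  have -> : A0 = (A0 `^ th) `^ th^-1 by rewrite -powRrM divff ?gt_eqF// powRr1.
  have -> : La `^ (n%:R / p) = (La `^ (p - 1)^-1) `^ th^-1.
    by rewrite -powRrM /th /theta; congr powR; field; rewrite !gt_eqF.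
  have D1 : 0 <= 2 * decay_cst n p * 2 `^ (1 + th^-1).
    by rewrite !mulr_ge0 ?powR_ge0// ltW.
  rewrite -!powRM ?mulr_ge0 ?powR_ge0//.
  apply: ge0_ler_powR; rewrite ?nnegrE ?invr_ge0 ?(ltW th0) ?(ltW M0)//.
    by rewrite !mulr_ge0 ?powR_ge0// ltW.
  by apply: (le_trans h); rewrite le_eqVlt; apply/orP; left; apply/eqP; ring.
have Mr : 0 < M `^ r by rewrite powR_gt0.
have {}hA : A0 * M `^ r <= 2 `^ r * N `^ r.
  have -> : A0 * M `^ r = 2 `^ r * ((M / 2) `^ r * A0).
    rewrite powRM ?(ltW M0)// ?invr_ge0// -powR_inv1// -powRrM mulN1r powRN.
    by field; rewrite gt_eqF// powR_gt0.
  by rewrite ler_wpM2l ?powR_ge0.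
have {h hA} hM : M `^ (th^-1 + r) <= cst0 n p r * La `^ (n%:R / p) * N `^ r.
  rewrite powRD ?(gt_eqF M0) ?implybT//.
  apply: (@le_trans _ _ ((2 * decay_cst n p * 2 `^ (1 + th^-1)) `^ th^-1 *
    La `^ (n%:R / p) * A0 * M `^ r)); first by rewrite ler_wpM2r// ltW.
  rewrite -mulrA.
  apply: (@le_trans _ _ ((2 * decay_cst n p * 2 `^ (1 + th^-1)) `^ th^-1 *
    La `^ (n%:R / p) * (2 `^ r * N `^ r))).
    by rewrite ler_wpM2l// mulr_ge0 ?powR_ge0.
  by rewrite le_eqVlt; apply/orP; left; apply/eqP; rewrite /cst0 -/th; ring.
have G0 := cst0_gt0 p r n0.
have np : 0 <= n%:R / p by rewrite divr_ge0// ltW.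
have e1 : 0 < n%:R * (p - q) + r * p.
  by rewrite ltr_wpDl// ?mulr_gt0// mulr_ge0 ?subr_ge0// ltW.
have e2 : 0 < n%:R * (p - 1) + r * p by rewrite addr_gt0// mulr_gt0.
have [dc|cd] := leP (d + 1) (2 * (c + 1) * M `^ (q - 1)).
- rewrite le_max; apply/orP; left.
  have La1 : La `^ (n%:R / p) <= (4 * (c + 1)) `^ (n%:R / p) * M `^ ((q - 1) * (n%:R / p)).
    rewrite powRrM -powRM ?powR_ge0//; last by rewrite mulr_ge0// ltW.
    apply: ge0_ler_powR; rewrite ?nnegrE ?(ltW La0)//.
      by rewrite mulr_ge0 ?powR_ge0// mulr_ge0// ltW.
    rewrite /La; have -> : 4 * (c + 1) * M `^ (q - 1) = 2 * (c + 1) * M `^ (q - 1) + 2 * (c + 1) * M `^ (q - 1) by ring.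
    by rewrite lerD2l.
  have B0 : 0 <= cst0 n p r * (4 * (c + 1)) `^ (n%:R / p) by rewrite mulr_ge0 ?powR_ge0// ltW.
  have e0 : 0 < (n%:R * (p - q) + r * p) / p by rewrite divr_gt0.
  have hh : M `^ ((n%:R * (p - q) + r * p) / p) <=
      cst0 n p r * (4 * (c + 1)) `^ (n%:R / p) * N `^ r.
    (* The power of [M] carried by [Lambda] moves to the left, lowering the exponent 1/theta + r to
       (n(p-q) + rp)/p. *)
    have Mq : 0 < M `^ ((q - 1) * (n%:R / p)) by rewrite powR_gt0.
    rewrite -(ler_pM2r Mq) -powRD ?(gt_eqF M0) ?implybT//.
    have -> : (n%:R * (p - q) + r * p) / p + (q - 1) * (n%:R / p) = th^-1 + r.
      by rewrite /th /theta; field; rewrite !gt_eqF.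
    apply: (le_trans hM).
    apply: (@le_trans _ _ (cst0 n p r * ((4 * (c + 1)) `^ (n%:R / p) *
      M `^ ((q - 1) * (n%:R / p))) * N `^ r)).
      by rewrite ler_wpM2r ?powR_ge0// ler_wpM2l// ltW.
    by rewrite le_eqVlt; apply/orP; left; apply/eqP; ring.
  have := powR_root M0 N0 B0 e0 hh; rewrite /cst1 invf_div => /le_trans; apply.
  by rewrite le_eqVlt; apply/orP; left; apply/eqP; congr (_ * N `^ _); field; rewrite !gt_eqF.
- rewrite le_max; apply/orP; right.
  have La1 : La `^ (n%:R / p) <= (2 * (d + 1)) `^ (n%:R / p).
    apply: ge0_ler_powR; rewrite ?nnegrE ?(ltW La0)//.
      by rewrite mulr_ge0// ltW.
    rewrite /La; have -> : 2 * (d + 1) = (d + 1) + (d + 1) by ring.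
    by rewrite lerD2r ltW.
  have B0 : 0 <= cst0 n p r * (2 * (d + 1)) `^ (n%:R / p) by rewrite mulr_ge0 ?powR_ge0// ltW.
  have e0 : 0 < (n%:R * (p - 1) + r * p) / p by rewrite divr_gt0.
  have hh : M `^ ((n%:R * (p - 1) + r * p) / p) <=
      cst0 n p r * (2 * (d + 1)) `^ (n%:R / p) * N `^ r.
    have -> : (n%:R * (p - 1) + r * p) / p = th^-1 + r.
      by rewrite /th /theta; field; rewrite !gt_eqF.
    apply: (le_trans hM).
    by rewrite ler_wpM2r ?powR_ge0// ler_wpM2l// ltW.
  have := powR_root M0 N0 B0 e0 hh; rewrite /cst2 invf_div => /le_trans; apply.
  by rewrite le_eqVlt; apply/orP; left; apply/eqP; congr (_ * N `^ _); field; rewrite !gt_eqF.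
Qed.

End constants.

(** * Essential supremum and application to weak solutions *)

Section ess_sup_facts.
Context {R : realType} {n : nat}.
Implicit Types (Omega : set 'rV[R]_n) (w : 'rV[R]_n -> R).
Local Notation mu := (lebesgue_rV n).

Lemma LnormOn_infty_ae Omega w (M : R) : 0 < M ->
  LnormOn Omega +oo w = M%:E -> {ae mu, forall x, Omega x -> `|w x| <= M}.
Proof.
move=> M0; rewrite /LnormOn unlock /=.
(* The norm is 0 by convention when the whole space is null, which [M > 0] excludes. *)
case: ifPn => [_ E|_ [] E]; last by rewrite -E ltxx in M0.
have := ess_sup_ge mu (abse \o (EFin \o (w \_ Omega))).
rewrite E; apply: filterS => x /=; rewrite lee_fin patchE => h Ox.
by rewrite mem_set// in h.
Qed.

Lemma LnormOn_infty_le Omega w (t : R) : 0 <= t -> measurable Omega ->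
  measurable_fun Omega w -> mu (level Omega w t) = 0%E ->
  (LnormOn Omega +oo w <= t%:E)%E.
Proof.
move=> t0 mO mw l0; rewrite /LnormOn unlock /=.
case: ifPn => _; last by rewrite lee_fin.
apply/ess_supP; exists (level Omega w t); split => //.
  exact: measurable_level.
move=> x /= nx; apply: contrapT => nl; apply: nx.
rewrite patchE; case: ifPn => [|_]; last by rewrite normr0 lee_fin.
rewrite inE => Ox; rewrite lee_fin leNgt; apply/negP => h; exact: nl.
Qed.

End ess_sup_facts.

Lemma le_maxe_pinfty {R : realType} (x K1 K2 e1 e2 : R) : 0 < K1 -> e1 != 0 ->
  (x%:E <= maxe (K1%:E * +oo `^ e1) (K2%:E * +oo `^ e2))%E.
Proof.
by move=> K10 e10; rewrite poweRyr// gt0_muley ?lte_fin// maxye leey.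
Qed.

Lemma EFin_le_maxe {R : realType} (x K1 K2 N e1 e2 : R) :
  x <= Num.max (K1 * N `^ e1) (K2 * N `^ e2) ->
  (x%:E <= maxe (K1%:E * N%:E `^ e1) (K2%:E * N%:E `^ e2))%E.
Proof. by move=> h; rewrite !poweR_EFin -!EFinM -EFin_max lee_fin. Qed.

Section main.
Context {R : realType} {n : nat}.
Local Notation mu := (lebesgue_rV n).

(** For q < 1 the power |t|^(q-1) is decreasing, and at M/2 it equals 2^(1-q) M^(q-1), where 2^(1-q)
    <= 2 since q > 0. *)
Lemma growth_le (f : R -> R) (q c d M t : R) : 0 < M -> 0 < q -> 0 <= c ->
  growth_condition q c d f ->
  M / 2 < `|t| -> `|t| <= M -> `|f t| <= 2 * (c + 1) * M `^ (q - 1) + (d + 1).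
Proof.
move=> M0 q0 c0 gf tM Mt.
have M20 : 0 < M / 2 by rewrite divr_gt0.
have t0 : 0 < `|t| by rewrite (lt_trans _ tM).
have h : `|f t| <= c * `|t| `^ (q - 1) + d by apply: gf; left; rewrite -normr_gt0.
have Mq : 0 <= M `^ (q - 1) by exact: powR_ge0.
have tq : `|t| `^ (q - 1) <= 2 * M `^ (q - 1).
  have [q1|q1] := leP 1 q.
    apply: (@le_trans _ _ (M `^ (q - 1))); last by lra.
    by rewrite ge0_ler_powR ?nnegrE ?subr_ge0 ?(ltW M0).
  have -> : q - 1 = - (1 - q) by ring.
  apply: (@le_trans _ _ ((M / 2) `^ (- (1 - q)))).
    rewrite !powRN lef_pV2 ?posrE ?powR_gt0//.
    by rewrite ge0_ler_powR ?nnegrE ?subr_ge0 ?(ltW q1) ?(ltW M20) ?(ltW tM).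
  rewrite powRM ?(ltW M0)// mulrC ler_wpM2r ?powR_ge0//.
  rewrite -powR_inv1// -powRrM mulrNN mul1r -[leRHS]powRr1//.
  by rewrite ler_powR; lra.
apply: (le_trans h); apply: lerD; last by lra.
apply: (@le_trans _ _ (c * (2 * M `^ (q - 1)))); first by rewrite ler_wpM2l.
by nra.
Qed.

Lemma continuous_bounded_itv (f : R -> R) (M : R) : 0 <= M -> continuous f ->
  exists2 F, 0 <= F & forall t, `|t| <= M -> `|f t| <= F.
Proof.
move=> M0 cf.
have MM : - M <= M by lra.
have [||c _ hc] := @EVT_max R (fun t => `|f t|) (- M) M.
- exact: MM.
- apply: continuous_subspaceT => t.
  apply: (@continuous_comp _ _ _ f (fun y : R => `|y|)); first exact: cf.
  exact: norm_continuous.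
exists `|f c| => // t; rewrite ler_norml => tM; apply: hc.
by rewrite in_itv.
Qed.

Lemma weak_solution_level_decay (Omega : set 'rV[R]_n)
    (a : 'rV[R]_n -> 'rV[R]_n -> 'rV[R]_n) (f : R -> R) (w : 'rV[R]_n -> R)
    (p q c d M k h alpha : R) :
  (0 < n)%N -> 1 < p -> 0 < q -> 0 <= c -> 0 <= d -> 0 < M ->
  open Omega -> bounded_set Omega -> structure_conditions Omega p a ->
  continuous f -> growth_condition q c d f -> weak_solution Omega p a f w ->
  {ae mu, forall x, Omega x -> `|w x| <= M} ->
  M / 2 <= k -> k < h -> 0 <= alpha -> (mu (level Omega w k) <= alpha%:E)%E ->
  (mu (level Omega w h) <= (decay_cst n p *
      (2 * (c + 1) * M `^ (q - 1) + (d + 1)) `^ (p - 1)^-1 / (h - k)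
      * alpha `^ (1 + theta n p))%:E)%E.
Proof.
move=> n0 p1 q0 c0 d0 M0 oO bO ha cf gf [g Wg weak] wM Mk kh al0 Al.
have mO := open_measurable_rV oO.
have Ooo := bounded_lebesgue_rV_lty mO bO.
have p0 : 0 < p by rewrite (lt_trans ltr01).
have [[[mw woo] gLp _] _] := Wg.
have mg i : measurable_fun Omega (fun x => g x ord0 i) by have [] := gLp i.
have [F F0 hF] := continuous_bounded_itv (ltW M0) cf.
have [C C0 hC] := structure_growth p1 ha.
have mA i : measurable_fun Omega (fun x => a x (g x) ord0 i).
  have [ca _ _ _ _] := ha.
  exact: (@measurable_field _ _ Omega (fun y => a y.1 y.2) g i).
have mnw : measurable_fun Omega (fun x => `|w x|) by exact: measurableT_comp.
have mfw : measurable_fun Omega (fun x => f (w x)).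
  exact: (measurableT_comp (continuous_measurable_fun cf)).
(* [w] is bounded by [M] only almost everywhere. Cutting f(w) off on the exceptional null set gives
   a bound at every point and leaves the integrals of the weak equation unchanged. *)
pose b x := \1_(`[- M, M]%classic : set (measurableTypeR R)) (w x) * f (w x).
have mb : measurable_fun Omega b.
  apply: measurable_funM => //.
  have mI : measurable_fun setT
      (\1_(`[- M, M]%classic : set (measurableTypeR R)) : _ -> R).
    exact: measurable_indic.
  exact: (measurableT_comp mI mw).
have bE x : `|w x| <= M -> b x = f (w x).
  by move=> xM; rewrite /b indicE mem_set ?mul1r//= in_itv/= -ler_norml.
have b0 x : M < `|w x| -> b x = 0.
  move=> xM; rewrite /b indicE memNset ?mul0r//= in_itv/= -ler_norml.
  by apply/negP; rewrite -ltNge.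
apply: (@level_decay _ _ Omega p _ F C w b g (fun x => a x (g x))) => //.
- rewrite addr_gt0 ?mulr_gt0 ?powR_gt0//; lra.
(* Integrability of [w] from |w| <= 1 + |w|^p on a set of finite measure. *)
- apply: (@le_lt_trans _ _ (\int[mu]_(x in Omega) (1 + `|w x| `^ p)%:E)%E).
    apply: ge0_le_integralE => //.
      by apply: measurable_funD => //; exact: measurable_powRn.
    move=> x _; rewrite normr_ge0/=.
    by have := young1 p1 (normr_ge0 (w x)) ltr01; rewrite powR1 mul1r.
  rewrite ge0_integralDE//; last exact: measurable_powRn.
  rewrite integral_cst// mul1e lte_add_pinfty// -LnormOn_powR//.
  exact: poweR_lty.
- exact: enorm_Lp_lty.
- by move=> x i Ox; exact: hC.
- by move=> x Ox; exact: (structure_coercive _ p1 ha Ox).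
- move=> x Ox; have [xM|xM] := leP `|w x| M; first by rewrite bE// hF.
  by rewrite b0// normr0.
- move=> psi tpsi; rewrite weak//.
  have [Cpsi _ _] := tpsi.
  have mpsi : measurable_fun Omega psi.
    by apply: measurable_funTS; apply: continuous_measurable_rV; exact: (Cpsi 0%N).
  apply: ae_eq_integral => //.
  + by apply/measurable_EFinP; exact: measurable_funM.
  + by apply/measurable_EFinP; exact: measurable_funM.
  + by apply: filterS wM => x h1 Ox; rewrite bE// h1.
- by move=> eta eta0; exact: W1p0_approx.
- by apply: lt_le_trans Mk; rewrite divr_gt0.
- move=> x Ox kx; have [xM|xM] := leP `|w x| M; last first.
    by rewrite b0// normr0 addr_ge0 ?mulr_ge0 ?powR_ge0//; lra.
  by rewrite bE//; apply: growth_le => //; exact: le_lt_trans kx.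
Qed.

(** The iteration from the level M/2 yields |w| <= M/2 + D almost everywhere. As M is the essential
    supremum of |w|, this forces M <= 2 D. *)
Lemma weak_solution_bound (Omega : set 'rV[R]_n)
    (a : 'rV[R]_n -> 'rV[R]_n -> 'rV[R]_n) (f : R -> R) (w : 'rV[R]_n -> R)
    (p q c d M : R) :
  (0 < n)%N -> 1 < p -> 0 < q -> 0 <= c -> 0 <= d -> 0 < M ->
  open Omega -> bounded_set Omega -> structure_conditions Omega p a ->
  continuous f -> growth_condition q c d f -> weak_solution Omega p a f w ->
  LnormOn Omega +oo w = M%:E ->
  M <= 2 * (decay_cst n p *
     (2 * (c + 1) * M `^ (q - 1) + (d + 1)) `^ (p - 1)^-1 *
     fine (mu (level Omega w (M / 2))) `^ theta n p * 2 `^ (1 + (theta n p)^-1)).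
Proof.
move=> n0 p1 q0 c0 d0 M0 oO bO ha cf gf ws wM.
have aeM := LnormOn_infty_ae M0 wM.
have mO := open_measurable_rV oO.
have Ooo := bounded_lebesgue_rV_lty mO bO.
have mw : measurable_fun Omega w by have [g [[[]]]] := ws.
pose A t := fine (mu (level Omega w t)).
have Afin t : mu (level Omega w t) \is a fin_num.
  rewrite ge0_fin_numE//; apply: le_lt_trans Ooo.
  apply: le_measure; rewrite ?inE//; first exact: measurable_level.
  by move=> x [].
have AE t : mu (level Omega w t) = (A t)%:E by rewrite fineK.
have A0 t : 0 <= A t by rewrite fine_ge0.
have Am : {homo A : s t / s <= t >-> t <= s}.
  move=> s t st; rewrite -lee_fin -!AE.
  apply: le_measure; rewrite ?inE; [exact: measurable_level..|].
  by move=> x [Ox tx]; split => //; exact: le_lt_trans tx.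
set La := _ + (d + 1).
have nR : 0 < n%:R :> R by rewrite ltr0n.
have th0 : 0 < theta n p.
  by rewrite divr_gt0 ?mulr_gt0 ?subr_gt0// (lt_trans ltr01).
have La0 : 0 < La by rewrite addr_gt0 ?mulr_gt0 ?powR_gt0//; lra.
have K0 : 0 < decay_cst n p * La `^ (p - 1)^-1.
  by rewrite mulr_gt0 ?powR_gt0// decay_cst_gt0.
have HA k h : M / 2 <= k -> k < h ->
    A h <= decay_cst n p * La `^ (p - 1)^-1 / (h - k) * A k `^ (1 + theta n p).
  move=> Mk kh; rewrite -lee_fin -AE.
  apply: (@weak_solution_level_decay Omega a f w p q c d M k h (A k)) => //.
  by rewrite AE.
have := stampacchia th0 K0 A0 Am HA.
rewrite -/(A _); set D := _ * _ * _ => AD.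
have D0 : 0 <= D.
  by rewrite /D !mulr_ge0 ?powR_ge0// ltW// decay_cst_gt0.
have : (LnormOn Omega +oo w <= (M / 2 + D)%:E)%E.
  apply: LnormOn_infty_le => //; first by rewrite addr_ge0// divr_ge0// ltW.
  by rewrite AE AD.
by rewrite wM lee_fin; lra.
Qed.

Lemma level_LnormOn (Omega : set 'rV[R]_n) (w : 'rV[R]_n -> R) (t r : R) :
  0 < t -> 0 < r -> measurable Omega -> measurable_fun Omega w ->
  ((t `^ r)%:E * mu (level Omega w t) <= LnormOn Omega r%:E w `^ r)%E.
Proof.
move=> t0 r0 mO mw; rewrite LnormOn_powR//; apply: ge0_integral_setE => //.
- exact: measurable_level.
- by move=> x [].
- by rewrite powR_ge0.
- by apply: measurable_powRn; exact: measurableT_comp.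
- move=> x [Ox tx]; apply: ge0_ler_powR; rewrite ?nnegrE//.
  + exact: ltW.
  + exact: ltW.
  + exact: ltW.
Qed.

End main.

Theorem theorem7p2 (R : realType) :
  exists (C1 : nat -> R -> R -> R -> R -> R -> R)
         (C2 : nat -> R -> R -> R -> R -> R),
  forall (n : nat) (p q r rho c d : R),
    (0 < n)%N -> 1 < p -> 0 < q <= p -> 0 < r -> 1 < rho ->
    0 <= c -> 0 <= d ->
    [/\ 0 < C1 n p q r rho c, 0 < C2 n p r rho d &
    forall (Omega : set 'rV[R]_n) (a : 'rV[R]_n -> 'rV[R]_n -> 'rV[R]_n)
           (f : R -> R) (w : 'rV[R]_n -> R),
      open Omega -> bounded_set Omega ->
      structure_conditions Omega p a ->
      (forall t, derivable f t 1) -> continuous (derive1 f) ->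
      growth_condition q c d f ->
      weak_solution Omega p a f w ->
      (LnormOn Omega +oo w < +oo)%E ->
      (LnormOn Omega +oo w <=
         maxe ((C1 n p q r rho c)%:E *
                 LnormOn Omega r%:E w `^ (r * p / (n%:R * (p - q) + r * p)))
              ((C2 n p r rho d)%:E *
                 LnormOn Omega r%:E w `^ (r * p / (n%:R * (p - 1) + r * p))))%E].
Proof.
exists cst1, cst2 => n p q r rho c d n0 p1 qp r0 _ c0 d0.
have C10 : 0 < cst1 n p q r rho c.
  by rewrite powR_gt0// mulr_gt0 ?cst0_gt0// powR_gt0 ?mulr_gt0// ltr_wpDl.
have C20 : 0 < cst2 n p r rho d.
  by rewrite powR_gt0// mulr_gt0 ?cst0_gt0// powR_gt0 ?mulr_gt0// ltr_wpDl.
split=> // Omega a f w oO bO ha df _ gf ws woo.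
have w0 : (0 <= LnormOn Omega +oo w)%E by exact: Lnorm_ge0.
have Mf : LnormOn Omega +oo w \is a fin_num by rewrite ge0_fin_numE.
set M := fine (LnormOn Omega +oo w).
have wM : LnormOn Omega +oo w = M%:E by rewrite fineK.
have M0 : 0 <= M by rewrite fine_ge0.
rewrite wM; move: M0; rewrite le_eqVlt => /predU1P[<-|M0].
  rewrite le_max; apply/orP; left; apply: mule_ge0; last exact: poweR_ge0.
  rewrite lee_fin; exact: (ltW C10).
have nR : 0 < n%:R :> R by rewrite ltr0n.
have p0 : 0 < p by rewrite (lt_trans ltr01).
have cf : continuous f.
  by move=> t; apply/differentiable_continuous/derivable1_diffP.
have mO := open_measurable_rV oO.
have Ooo := bounded_lebesgue_rV_lty mO bO.
have mw : measurable_fun Omega w by have [g [[[]]]] := ws.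
have N0 : (0 <= LnormOn Omega r%:E w)%E by exact: Lnorm_ge0.
have [q0 qlep] := andP qp.
have [Noo|Nfin] := eqVneq (LnormOn Omega r%:E w) +oo%E.
  (* The exponent has to be nonzero, because [+oo] to the power 0 is 1. *)
  have e0 : r * p / (n%:R * (p - q) + r * p) != 0.
    rewrite gt_eqF// divr_gt0 ?mulr_gt0//.
    by rewrite ltr_wpDl ?mulr_gt0// mulr_ge0 ?subr_ge0// ltW.
  by rewrite Noo; exact: (le_maxe_pinfty _ _ _ C10 e0).
have NE : LnormOn Omega r%:E w = (fine (LnormOn Omega r%:E w))%:E.
  by rewrite fineK// ge0_fin_numE// ltey.
set N := fine _ in NE.
have N0' : 0 <= N by rewrite fine_ge0.
have bound := weak_solution_bound n0 p1 q0 c0 d0 M0 oO bO ha cf gf ws wM.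
have Afin : lebesgue_rV n (level Omega w (M / 2)) \is a fin_num.
  rewrite ge0_fin_numE//; apply: le_lt_trans Ooo.
  apply: le_measure; rewrite ?inE//; first exact: measurable_level.
  by move=> x [].
have M20 : 0 < M / 2 by rewrite divr_gt0.
have lev := level_LnormOn M20 r0 mO mw.
rewrite NE -(fineK Afin) poweR_EFin -EFinM lee_fin in lev.
rewrite NE; apply: EFin_le_maxe.
apply: constants_bound lev bound => //.
by rewrite fine_ge0.
Qed.
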